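(* If $A$ is a TAR policy with policy limits that are almost surely positive, then the MLE $\hat\alpha_n$ is consistent under $A$, i.e. $\hat\alpha_n\to\alpha$ in probability as $n\to\infty$.
   Context: Setting. $S$ is a finite state space; $P(\ell)=(P(\ell,x,y):x,y\in S)$, $\ell=1,2$, are two irreducible stochastic matrices on $S$, with unique stationary distributions $\pi(\ell)=(\pi(\ell,x):x\in S)$ (row vectors). For each $\ell,x,y$, $F(\cdot|\ell,x,y)$ is a cumulative distribution function on $\mathbb{R}$ with bounded support. The sample space carries random variables $X_n\in S$, $U_n,V_n\in[0,1]$, $n\ge0$, and $\mathcal{G}_n=\sigma((X_j,U_j,V_j):0\le j\le n)$. A policy is a sequence $A=(A_n:n\ge0)$ of $\{1,2\}$-valued random variables adapted to $(\mathcal{G}_n)$. Under a policy $A$ (and an arbitrary initial state), the $U_n$ and $V_n$ are independent i.i.d. uniform$[0,1]$ sequences and, for Borel $B,C\subset[0,1]$ and Lebesgue measure $\mu$, $P(X_{n+1}=y,U_{n+1}\in B,V_{n+1}\in C\mid\mathcal{G}_n)=P(A_n,X_n,y)\mu(B)\mu(C)$. The reward at time $n\ge1$ is $R_n=F^{-1}(V_n|A_{n-1},X_{n-1},X_n)$ (generalized inverse). Put $r(\ell,x)=\sum_{y\in S}P(\ell,x,y)\int_{\mathbb{R}} z\,F(dz|\ell,x,y)$, $\alpha(\ell)=\sum_{x}\pi(\ell,x)r(\ell,x)$, and $\alpha=\alpha(2)-\alpha(1)$. MLE. Let $\Gamma_n(\ell,x)=\sum_{j=0}^{n-1}I(X_j=x,A_j=\ell)$,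 $\hat P_n(\ell,x,y)=\sum_{j=0}^{n-1}I(X_j=x,A_j=\ell,X_{j+1}=y)/\max\{\Gamma_n(\ell,x),1\}$, and $\hat r_n(\ell,x)=\sum_{j=0}^{n-1}I(X_j=x,A_j=\ell)R_{j+1}/\max\{\Gamma_n(\ell,x),1\}$. Let $J=\min\{n\ge0:\hat P_n(\ell)\text{ is an irreducible stochastic matrix for }\ell=1,2\}$. For $n\ge J$, $\hat\pi_n(\ell)$ is the unique stationary distribution of $\hat P_n(\ell)$ and the MLE is $\hat\alpha_n=\hat\pi_n(2)\hat r_n(2)-\hat\pi_n(1)\hat r_n(1)$. For $n<J$, set $\hat\pi_n(\ell,x)=1/|S|$, $\hat r_n(\ell,x)=0$, $\hat\alpha_n=0$. TAR policies. A policy $A$ is time-average regular (TAR) with (possibly random) policy limits $\gamma=(\gamma(\ell,x):x\in S,\ell=1,2)$ if $\frac1n\Gamma_n(\ell,x)\to\gamma(\ell,x)$ in probability as $n\to\infty$ for every $x\in S$, $\ell=1,2$. *)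

(* Defs.v *)
From HB Require Import structures.
From mathcomp Require Import all_boot all_order all_algebra.
From mathcomp Require Import all_classical all_reals all_analysis.
From mathcomp Require Import measurable_realfun.

Set Implicit Arguments.
Unset Strict Implicit.
Unset Printing Implicit Defensive.

Import Order.TTheory GRing.Theory Num.Theory.
Import numFieldNormedType.Exports.

Local Open Scope classical_set_scope.
Local Open Scope ring_scope.

(* The two actions 1 and 2 are the two elements of 'I_2, in this order. *)
Definition act1 : 'I_2 := ord0.
Definition act2 : 'I_2 := ord_max.

(* Matrices indexed by the finite state space S are functions Q : S -> S -> R,
   and row or column vectors are functions S -> R. *)

Definition stochastic (R : realType) (S : finType) (Q : S -> S -> R) : Prop :=
  (forall x y, 0 <= Q x y) /\ (forall x, \sum_(y : S) Q x y = 1).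

Fixpoint kpow (R : realType) (S : finType) (Q : S -> S -> R) (n : nat)
    : S -> S -> R :=
  match n with
  | 0%N => fun x y => (x == y)%:R
  | n'.+1 => fun x y => \sum_(z : S) Q x z * kpow Q n' z y
  end.

Definition irreducible (R : realType) (S : finType) (Q : S -> S -> R) : Prop :=
  forall x y, exists n, 0 < kpow Q n x y.

Definition irreducible_stochastic (R : realType) (S : finType)
    (Q : S -> S -> R) : Prop :=
  stochastic Q /\ irreducible Q.

Definition is_stationary (R : realType) (S : finType) (Q : S -> S -> R)
    (p : S -> R) : Prop :=
  [/\ forall x, 0 <= p x,
      \sum_(x : S) p x = 1
    & forall y, \sum_(x : S) p x * Q x y = p y].

(* The stationary distribution of Q. It is only used when Q is irreducible and
   stochastic, in which case exactly one p satisfies [is_stationary Q p]; the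
   default value is then irrelevant. *)
Definition stationary (R : realType) (S : finType) (Q : S -> S -> R) : S -> R :=
  xget (fun=> 0) [set p | is_stationary Q p].

Definition bounded_support (R : realType) (G : cumulativeBounded (0 : R) 1)
    : Prop :=
  exists M : R, lebesgue_stieltjes_measure G (~` `[- M, M]) = 0%E.

(* Generalized inverse of a cumulative distribution function. When G has bounded
   support, the infimum is a genuine one for 0 < v <= 1; for v = 0 the set is R,
   and [inf] returns the conventional value 0 instead of -oo (when v is uniformly
   distributed, this is a null event). *)
Definition quantile (R : realType) (G : R -> R) (v : R) : R :=
  inf [set z | v <= G z].

Definition exp_reward (R : realType) (S : finType) (P : 'I_2 -> S -> S -> R)
    (F : 'I_2 -> S -> S -> cumulativeBounded (0 : R) 1) (l : 'I_2) (x : S) : R :=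
  \sum_(y : S)
    P l x y * (\int[lebesgue_stieltjes_measure (F l x y)]_(z in setT) z).

Definition avg_reward (R : realType) (S : finType) (P : 'I_2 -> S -> S -> R)
    (F : 'I_2 -> S -> S -> cumulativeBounded (0 : R) 1) (l : 'I_2) : R :=
  \sum_(x : S) stationary (P l) x * exp_reward P F l x.

Definition alpha (R : realType) (S : finType) (P : 'I_2 -> S -> S -> R)
    (F : 'I_2 -> S -> S -> cumulativeBounded (0 : R) 1) : R :=
  avg_reward P F act2 - avg_reward P F act1.

(* The sigma-algebra generated by X_j, U_j, V_j for 0 <= j <= n; the finite set S
   carries its discrete sigma-algebra. *)
Definition filtration (R : realType) (S : finType) (T : Type)
    (X : nat -> T -> S) (U V : nat -> T -> R) (n : nat) : set (set T) :=
  <<s [set E | exists2 j, (j <= n)%N &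
        [\/ exists x : S, E = X j @^-1` [set x],
            exists2 B : set R, measurable B & E = U j @^-1` B
          | exists2 B : set R, measurable B & E = V j @^-1` B]] >>.

Definition policy (R : realType) (S : finType) (T : Type)
    (X : nat -> T -> S) (U V : nat -> T -> R) (A : nat -> T -> 'I_2) : Prop :=
  forall n l, filtration X U V n (A n @^-1` [set l]).

(* K is a version of the conditional probability of the event E given the
   sub-sigma-algebra G. *)
Definition is_cond_prob (R : realType) (d : measure_display)
    (T : measurableType d) (Pr : probability T R)
    (G : set (set T)) (E : set T) (K : T -> \bar R) : Prop :=
  (forall B : set (\bar R), measurable B -> G (K @^-1` B)) /\
  (forall D, G D -> Pr (E `&` D) = \int[Pr]_(w in D) K w)%E.

Definition mutually_independent (R : realType) (d : measure_display)
    (T : measurableType d) (Pr : probability T R)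
    (I : choiceType) (Z : I -> T -> R) : Prop :=
  forall (s : seq I) (B : I -> set R), uniq s ->
    (forall i, measurable (B i)) ->
    Pr (\bigcap_(i in [set` s]) (Z i @^-1` B i)) =
    (\prod_(i <- s) Pr (Z i @^-1` B i))%E.

Definition uniform01 (R : realType) (d : measure_display)
    (T : measurableType d) (Pr : probability T R) (Z : T -> R) : Prop :=
  forall B : set R, measurable B -> B `<=` `[0, 1] ->
    Pr (Z @^-1` B) = lebesgue_measure B.

(* Pr governs the process under the policy A. The law of X_0 is unconstrained:
   the initial state is arbitrary. *)
Record controlled_process (R : realType) (S : finType) (d : measure_display)
    (T : measurableType d) (Pr : probability T R) (P : 'I_2 -> S -> S -> R)
    (X : nat -> T -> S) (U V : nat -> T -> R) (A : nat -> T -> 'I_2) : Prop :=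
  ControlledProcess {
  cp_X_measurable : forall n x, measurable (X n @^-1` [set x]) ;
  cp_U_measurable : forall n, measurable_fun setT (U n) ;
  cp_V_measurable : forall n, measurable_fun setT (V n) ;
  cp_U_01 : forall n w, 0 <= U n w <= 1 ;
  cp_V_01 : forall n w, 0 <= V n w <= 1 ;
  cp_policy : policy X U V A ;
  cp_UV_independent : mutually_independent Pr
    (fun i : nat + nat => match i with inl n => U n | inr n => V n end) ;
  cp_U_uniform : forall n, uniform01 Pr (U n) ;
  cp_V_uniform : forall n, uniform01 Pr (V n) ;
  cp_transition : forall (n : nat) (y : S) (B C : set R),
    measurable B -> B `<=` `[0, 1] -> measurable C -> C `<=` `[0, 1] ->
    is_cond_prob Pr (filtration X U V n)
      (X n.+1 @^-1` [set y] `&` U n.+1 @^-1` B `&` V n.+1 @^-1` C)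
      (fun w => (P (A n w) (X n w) y)%:E * lebesgue_measure B
                * lebesgue_measure C)%E }.

(* The reward at time n, meaningful for n >= 1. *)
Definition reward (R : realType) (S : finType) (T : Type)
    (F : 'I_2 -> S -> S -> cumulativeBounded (0 : R) 1)
    (X : nat -> T -> S) (V : nat -> T -> R) (A : nat -> T -> 'I_2)
    (n : nat) (w : T) : R :=
  quantile (F (A n.-1 w) (X n.-1 w) (X n w)) (V n w).

Definition visits (S : finType) (T : Type) (X : nat -> T -> S)
    (A : nat -> T -> 'I_2) (n : nat) (l : 'I_2) (x : S) (w : T) : nat :=
  (\sum_(j < n) ((X j w == x) && (A j w == l)))%N.

Definition Phat (R : realType) (S : finType) (T : Type) (X : nat -> T -> S)
    (A : nat -> T -> 'I_2) (n : nat) (l : 'I_2) (w : T) (x y : S) : R :=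
  (\sum_(j < n) [&& X j w == x, A j w == l & X j.+1 w == y])%N%:R
  / (maxn (visits X A n l x w) 1)%:R.

(* The time J; it takes the value +oo when no n qualifies. *)
Definition Jtime (R : realType) (S : finType) (T : Type) (X : nat -> T -> S)
    (A : nat -> T -> 'I_2) (w : T) : \bar R :=
  ereal_inf [set (n%:R)%:E | n in
    [set n | forall l, irreducible_stochastic (Phat R X A n l w)]].

Definition pihat (R : realType) (S : finType) (T : Type) (X : nat -> T -> S)
    (A : nat -> T -> 'I_2) (n : nat) (l : 'I_2) (w : T) (x : S) : R :=
  if (Jtime R X A w <= (n%:R)%:E)%E then stationary (Phat R X A n l w) x
  else (#|S|%:R)^-1.

Definition rhat (R : realType) (S : finType) (T : Type)
    (F : 'I_2 -> S -> S -> cumulativeBounded (0 : R) 1)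
    (X : nat -> T -> S) (V : nat -> T -> R) (A : nat -> T -> 'I_2)
    (n : nat) (l : 'I_2) (w : T) (x : S) : R :=
  if (Jtime R X A w <= (n%:R)%:E)%E then
    (\sum_(j < n) ((X j w == x) && (A j w == l))%:R * reward F X V A j.+1 w)
    / (maxn (visits X A n l x w) 1)%:R
  else 0.

Definition alphahat (R : realType) (S : finType) (T : Type)
    (F : 'I_2 -> S -> S -> cumulativeBounded (0 : R) 1)
    (X : nat -> T -> S) (V : nat -> T -> R) (A : nat -> T -> 'I_2)
    (n : nat) (w : T) : R :=
  if (Jtime R X A w <= (n%:R)%:E)%E then
    \sum_(x : S) pihat R X A n act2 w x * rhat F X V A n act2 w x
    - \sum_(x : S) pihat R X A n act1 w x * rhat F X V A n act1 w x
  else 0.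

Definition cvg_in_prob (R : realType) (d : measure_display)
    (T : measurableType d) (Pr : probability T R)
    (Y : nat -> T -> R) (Z : T -> R) : Prop :=
  forall e : R, 0 < e ->
    Pr [set w | e <= `|Y n w - Z w|] @[n --> \oo] --> (0 : \bar R).

Definition TAR (R : realType) (S : finType) (d : measure_display)
    (T : measurableType d) (Pr : probability T R)
    (X : nat -> T -> S) (A : nat -> T -> 'I_2)
    (gamma : 'I_2 -> S -> T -> R) : Prop :=
  forall l x, cvg_in_prob Pr
    (fun n w => (n%:R)^-1 * (visits X A n l x w)%:R) (gamma l x).

(* Main.v *)
Require Import Defs.
From HB Require Import structures.
From mathcomp Require Import all_boot all_order all_algebra.
From mathcomp Require Import all_classical all_reals all_analysis.
From mathcomp Require Import ring lra measurable_realfun.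

(** On the random times at which the pair (x, l) is used, the indicators of
    "next state y and V in C", centred at P(l,x,y) |C|, are orthogonal martingale
    differences, so their sums are o(n) in probability by Chebyshev's inequality;
    since the number of such times is eventually at least c n off an event of
    small probability, they are also o(visits).  C = [0,1] gives the consistency of
    the transition estimates.  For the rewards, F^-1(V) is approximated uniformly by
    a step function whose steps are the intervals ]F(z_k), F(z_(k+1))] of V, whose
    lengths are the masses that F gives to ]z_k, z_(k+1)].  Finally the stationary
    distribution depends on an irreducible stochastic matrix in a Lipschitz way:
    with J the all-ones matrix, I - Q + J is invertible and
    p' - p = p' (Q' - Q) (I - Q + J)^-1. *)

Set Implicit Arguments.
Unset Strict Implicit.
Unset Printing Implicit Defensive.

Import Order.TTheory GRing.Theory Num.Theory.
Import numFieldNormedType.Exports.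

Local Open Scope classical_set_scope.
Local Open Scope ring_scope.

(** * Stationary distributions *)

Lemma sum_mul_delta (R : realType) (S : finType) (v : S -> R) (y : S) :
  \sum_(x : S) v x * (x == y)%:R = v y.
Proof.
rewrite (bigD1 y) //= eqxx mulr1 big1 ?addr0 // => x /negPf ->.
by rewrite mulr0.
Qed.

(** Transport to square matrices along [enum_rank] and [enum_val]: a trivial left kernel means row
    free, and a row free square matrix is a unit. *)
Lemma two_sided_inverse (R : realType) (S : finType) (f : S -> S -> R) :
  (forall v : S -> R, (forall y, \sum_x v x * f x y = 0) -> forall x, v x = 0) ->
  exists g : S -> S -> R,
    (forall x y, \sum_z f x z * g z y = (x == y)%:R) /\
    (forall x y, \sum_z g x z * f z y = (x == y)%:R).
Proof.
move=> f_inj.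
pose M : 'M[R]_#|S| := \matrix_(i, j) f (enum_val i) (enum_val j).
have Mfree : row_free M.
  rewrite -kermx_eq0; apply/eqP/row_matrixP => i; rewrite row0.
  pose u := row i (kermx M).
  have uM : u *m M = 0 by rewrite -row_mul mulmx_ker row0.
  apply/rowP => j; rewrite [RHS]mxE.
  have := f_inj (fun x => u 0 (enum_rank x)) _ (enum_val j).
  rewrite enum_valK; apply => y.
  rewrite (reindex _ (onW_bij _ (@enum_val_bij S))) /=.
  have /rowP/(_ (enum_rank y)) := uM.
  rewrite mxE [RHS]mxE => uy; rewrite -[RHS]uy; apply: eq_bigr => k _.
  by rewrite [M _ _]mxE enum_rankK enum_valK.
have Munit : M \in unitmx by rewrite -row_free_unit.
exists (fun x y => invmx M (enum_rank x) (enum_rank y)); split => x y.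
- have /matrixP/(_ (enum_rank x) (enum_rank y)) := mulmxV Munit.
  rewrite mxE [RHS]mxE (inj_eq enum_rank_inj) => <-.
  rewrite (reindex _ (onW_bij _ (@enum_val_bij S))) /=; apply: eq_bigr => k _.
  by rewrite [M _ _]mxE enum_rankK enum_valK.
- have /matrixP/(_ (enum_rank x) (enum_rank y)) := mulVmx Munit.
  rewrite mxE [RHS]mxE (inj_eq enum_rank_inj) => <-.
  rewrite (reindex _ (onW_bij _ (@enum_val_bij S))) /=; apply: eq_bigr => k _.
  by rewrite [M _ _]mxE enum_rankK enum_valK.
Qed.

Lemma kpow_ge0 (R : realType) (S : finType) (Q : S -> S -> R) n x y :
  (forall x y, 0 <= Q x y) -> 0 <= kpow Q n x y.
Proof.
move=> Q0; elim: n x => [|n IH] x /=; first exact: ler0n.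
by apply: sumr_ge0 => z _; rewrite mulr_ge0.
Qed.

(** A positive n-step weight comes from a path all of whose edges are positive for [Q]; the same
    path is positive for [Q']. The induction splits off its first edge. *)
Lemma kpow_gt0_sub (R : realType) (S : finType) (Q Q' : S -> S -> R) n x y :
  (forall x y, 0 <= Q x y) -> (forall x y, 0 <= Q' x y) ->
  (forall x y, 0 < Q x y -> 0 < Q' x y) ->
  0 < kpow Q n x y -> 0 < kpow Q' n x y.
Proof.
move=> Q0 Q'0 QQ'; elim: n x => [|n IH] x /=; first by [].
move=> sum_gt0.
have [[z zP]|all0] := pselect (exists z, 0 < Q x z * kpow Q n z y); last first.
  move: sum_gt0; rewrite big1 ?ltxx // => z _; apply/eqP.
  rewrite eq_le mulr_ge0 ?kpow_ge0 // andbT leNgt; apply/negP => ?.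
  by apply: all0; exists z.
move: zP; have := Q0 x z; rewrite le_eqVlt => /predU1P[<-|Qz].
  by rewrite mul0r ltxx.
rewrite pmulr_rgt0 // => /IH kz.
rewrite (bigD1 z) //= ltr_wpDr //; last by rewrite mulr_gt0 // QQ'.
by apply: sumr_ge0 => t _; rewrite mulr_ge0 // kpow_ge0.
Qed.

Lemma invariant_kpow (R : realType) (S : finType) (Q : S -> S -> R) (v : S -> R) n :
  (forall y, \sum_x v x * Q x y = v y) ->
  forall y, \sum_x v x * kpow Q n x y = v y.
Proof.
move=> vQ; elim: n => [|n IH] y /=; first exact: sum_mul_delta.
under eq_bigr do rewrite mulr_sumr.
rewrite exchange_big /= -[RHS]IH; apply: eq_bigr => z _.
by rewrite -[in RHS]vQ mulr_suml; apply: eq_bigr => x _; rewrite mulrA.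
Qed.

(** The triangle inequality gives |v| <= |v| Q entrywise; both sides have the same total because the
    rows of [Q] sum to 1, so no entry has slack. *)
Lemma invariant_norm (R : realType) (S : finType) (Q : S -> S -> R) (v : S -> R) :
  stochastic Q -> (forall y, \sum_x v x * Q x y = v y) ->
  forall y, \sum_x `|v x| * Q x y = `|v y|.
Proof.
move=> [Q0 Q1] vQ.
have le y : `|v y| <= \sum_x `|v x| * Q x y.
  rewrite -[in leLHS]vQ; apply: le_trans (ler_norm_sum _ _ _) _.
  by apply: ler_sum => x _; rewrite normrM (ger0_norm (Q0 _ _)).
have eqs : \sum_y (\sum_x `|v x| * Q x y - `|v y|) = 0.
  rewrite sumrB exchange_big /=.
  under eq_bigr do rewrite -mulr_sumr Q1 mulr1.
  by rewrite subrr.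
move=> y; apply/eqP; rewrite -subr_eq0; apply/eqP.
move/eqP: eqs; rewrite psumr_eq0; last by move=> i _; rewrite subr_ge0.
by move/allP => /(_ y (mem_index_enum y))/eqP.
Qed.

(** Since v = v Q^n for every n, positive mass at one state reaches any other state along a path of
    positive weight. *)
Lemma invariant_pos (R : realType) (S : finType) (Q : S -> S -> R) (v : S -> R) :
  irreducible_stochastic Q -> (forall x, 0 <= v x) ->
  (forall y, \sum_x v x * Q x y = v y) ->
  (exists x, v x != 0) -> forall y, 0 < v y.
Proof.
move=> [[Q0 _] irr] v0 vQ [x vx] y; have [n Qn] := irr x y.
rewrite -(invariant_kpow n vQ y) (bigD1 x) //= ltr_wpDr //.
  by apply: sumr_ge0 => t _; rewrite mulr_ge0 // kpow_ge0.
by rewrite mulr_gt0 // lt_neqAle eq_sym vx v0.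
Qed.

(** Linear form of the uniqueness of the stationary distribution: an invariant vector taking a
    positive (negative) value is positive (negative) everywhere, which a zero sum forbids. *)
Lemma invariant_zero_sum (R : realType) (S : finType) (Q : S -> S -> R) (v : S -> R) :
  irreducible_stochastic Q -> (forall y, \sum_x v x * Q x y = v y) ->
  \sum_x v x = 0 -> forall x, v x = 0.
Proof.
move=> irrQ vQ v0.
have aQ := invariant_norm irrQ.1 vQ.
(* |v| + v and |v| - v are nonnegative invariant vectors; irreducibility makes
   each of them identically zero or everywhere positive *)
have half (s : R) : `|s| <= 1 -> (exists x, `|v x| + s * v x != 0) ->
    forall y, 0 < `|v y| + s * v y.
  move=> s1; apply: (invariant_pos (v := fun x => `|v x| + s * v x) irrQ).
    move=> x; have : `|s * v x| <= `|v x| by rewrite normrM ler_piMl.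
    by rewrite ler_norml => /andP[? _]; rewrite -lerBlDl sub0r.
  move=> y; rewrite -(aQ y) -(vQ y) mulr_sumr -big_split; apply: eq_bigr => x _ /=.
  by rewrite mulrDl mulrA.
have pos x : 0 < v x -> forall y, 0 < v y.
  move=> vx y; rewrite ltNge; apply/negP => vy.
  have := half 1; rewrite normr1 lexx => /(_ isT) h.
  suff : 0 < `|v y| + 1 * v y by rewrite (ler0_norm vy) mul1r addNr ltxx.
  apply: h.
  by exists x; rewrite mul1r gtr0_norm // gt_eqF // addr_gt0.
have neg x : v x < 0 -> forall y, v y < 0.
  move=> vx y; rewrite ltNge; apply/negP => vy.
  have := half (-1); rewrite normrN1 lexx => /(_ isT) h.
  suff : 0 < `|v y| + -1 * v y by rewrite (ger0_norm vy) mulN1r subrr ltxx.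
  apply: h.
  by exists x; rewrite mulN1r ltr0_norm // gt_eqF // addr_gt0 // oppr_gt0.
move=> x; case: (ltrgt0P (v x)) => // vx.
- have vp := pos x vx.
  have /eqP := v0; rewrite psumr_eq0; last by move=> i _; rewrite ltW.
  by move/allP => /(_ x (mem_index_enum x))/eqP.
- have vp := neg x vx.
  have : \sum_x - v x == 0 by rewrite sumrN v0 oppr0.
  rewrite psumr_eq0; last by move=> i _; rewrite oppr_ge0 ltW.
  by move/allP => /(_ x (mem_index_enum x)); rewrite oppr_eq0 => /eqP.
Qed.

(** I - Q kills the constant vector on the right, so it is singular and has a nonzero left kernel
    vector v; normalising |v| gives the distribution. The state [x0] witnesses that [S] is
    nonempty. *)
Lemma stationary_exists (R : realType) (S : finType) (x0 : S) (Q : S -> S -> R) :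
  irreducible_stochastic Q -> is_stationary Q (stationary Q).
Proof.
move=> irrQ; have [Q0 Q1] := irrQ.1.
have [v [v0 vQ]] : exists v : S -> R, (exists x, v x != 0) /\
    (forall y, \sum_x v x * Q x y = v y).
  apply: contrapT => nov.
  have [|g [_ gf]] := @two_sided_inverse R S (fun x y => (x == y)%:R - Q x y).
    move=> v vI x; apply: contrapT => /eqP vx; apply: nov; exists v.
    split; first by exists x.
    move=> y; have := vI y; under eq_bigr do rewrite mulrBr.
    by rewrite sumrB sum_mul_delta => /eqP; rewrite subr_eq0 => /eqP <-.
  (* This sum is 1, but expanding the identity as g (I - Q) makes it 0, since the rows of I - Q sum
     to 0. *)
  have : \sum_y (x0 == y)%:R = 0 :> R.
    under eq_bigr do rewrite -gf.
    rewrite exchange_big big1 //= => z _; rewrite -mulr_sumr sumrB Q1.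
    rewrite (bigD1 z) //= eqxx big1 ?addr0 ?subrr ?mulr0 // => t.
    by rewrite eq_sym => /negPf ->.
  rewrite (bigD1 x0) //= eqxx big1 ?addr0; first by move/eqP; rewrite oner_eq0.
  by move=> t; rewrite eq_sym => /negPf ->.
have aQ := invariant_norm irrQ.1 vQ.
pose s := \sum_x `|v x|.
have s0 : 0 < s.
  move: v0 => [x vx]; rewrite /s (bigD1 x) //= ltr_wpDr ?normr_gt0 //.
  exact: sumr_ge0.
rewrite /stationary; apply: xgetPex; exists (fun x => `|v x| / s); split.
- by move=> x; rewrite divr_ge0 // ltW.
- by rewrite -mulr_suml divff // gt_eqF.
- move=> y; rewrite -aQ mulr_suml; apply: eq_bigr => x _.
  by rewrite mulrAC.
Qed.

Lemma stationary_lipschitz (R : realType) (S : finType) (Q : S -> S -> R) :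
  irreducible_stochastic Q ->
  exists2 K : R, 0 <= K & forall (Q' : S -> S -> R) (h : R),
    irreducible_stochastic Q' -> (forall x y, `|Q' x y - Q x y| <= h) ->
    forall x, `|stationary Q' x - stationary Q x| <= K * h.
Proof.
move=> irrQ; have [[x0 _]|noS] := pselect (exists x : S, True); last first.
  by exists 0 => // Q' h _ _ x; exfalso; apply: noS; exists x.
have [Q0 Q1] := irrQ.1.
have cardS : (#|S|%:R != 0 :> R).
  by rewrite pnatr_eq0 -lt0n; apply/card_gt0P; exists x0.
(* I - Q + J is invertible, J being the all-ones matrix *)
have [|g [fg _]] := @two_sided_inverse R S (fun x y => (x == y)%:R - Q x y + 1).
  move=> v vI.
  have vE y : v y - \sum_x v x * Q x y + \sum_x v x = 0.
    rewrite -[RHS](vI y) -[v y]sum_mul_delta -sumrB -big_split; apply: eq_bigr => x _ /=.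
    by rewrite mulrDr mulrBr mulr1.
  (* Summing [vE] over y cancels its first two terms and leaves |S| times the total of v. *)
  have sv : \sum_x v x = 0.
    have : \sum_y (v y - \sum_x v x * Q x y + \sum_x v x) = 0 by rewrite big1.
    rewrite big_split sumrB /= [X in _ - X]exchange_big /=.
    under [X in _ - X]eq_bigr do rewrite -mulr_sumr Q1 mulr1.
    rewrite subrr add0r sumr_const => /eqP.
    rewrite -[X in X == 0]mulr_natr mulf_eq0 (negPf cardS) orbF => /eqP //.
  apply: (invariant_zero_sum irrQ) => // y; have := vE y.
  by rewrite sv addr0 => /eqP; rewrite subr_eq0 => /eqP <-.
exists (#|S|%:R * \sum_x \sum_y `|g x y|).
  by rewrite mulr_ge0 // sumr_ge0 // => x _; rewrite sumr_ge0.
move=> Q' h irrQ' QQ'.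
have [p0 p1 pQ] := stationary_exists x0 irrQ.
have [p'0 p'1 p'Q] := stationary_exists x0 irrQ'.
set p := stationary Q in p0 p1 pQ *; set p' := stationary Q' in p'0 p'1 p'Q *.
have h0 : 0 <= h by apply: le_trans (normr_ge0 _) (QQ' x0 x0).
have diffE y : p' y - p y =
    \sum_z (\sum_x p' x * (Q' x z - Q x z)) * g z y.
  rewrite -[p' y - p y](sum_mul_delta (fun x => p' x - p x)).
  under eq_bigr do rewrite -fg mulr_sumr.
  rewrite exchange_big /=; apply: eq_bigr => z _.
  under eq_bigr do rewrite mulrA.
  rewrite -mulr_suml; congr (_ * _).
  (* The all-ones terms cancel because p and p' both have total 1, p drops out by p = p Q, and p' =
     p' Q' turns the rest into p' (Q' - Q). *)
  rewrite (eq_bigr (fun x => p' x * (x == z)%:R - p x * (x == z)%:R -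
     (p' x * Q x z - p x * Q x z) + (p' x - p x))); last by move=> x _; ring.
  rewrite big_split !sumrB /= !sum_mul_delta pQ p1 p'1 subrr addr0.
  under [RHS]eq_bigr do rewrite mulrBr.
  rewrite sumrB p'Q; ring.
move=> y; rewrite diffE; apply: le_trans (ler_norm_sum _ _ _) _.
have bnd z : `|\sum_x p' x * (Q' x z - Q x z)| <= h.
  apply: le_trans (ler_norm_sum _ _ _) _.
  rewrite -[leRHS]mul1r -p'1 mulr_suml; apply: ler_sum => x _.
  by rewrite normrM (ger0_norm (p'0 x)) ler_wpM2l.
have S1 : (1 : R) <= #|S|%:R.
  by rewrite ler1n; apply/card_gt0P; exists x0.
apply: (@le_trans _ _ (\sum_z h * \sum_t `|g z t|)).
  apply: ler_sum => z _; rewrite normrM ler_pM //.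
  by rewrite (bigD1 y) //= lerDl sumr_ge0.
rewrite -mulr_sumr mulrC ler_wpM2r // ler_peMl //.
by apply: sumr_ge0 => z _; apply: sumr_ge0.
Qed.

(** Irreducibility depends only on which entries are positive, and a perturbation smaller than the
    least positive entry keeps all of these positive. *)
Lemma irreducible_stochastic_near (R : realType) (S : finType) (Q : S -> S -> R) :
  irreducible_stochastic Q ->
  exists2 h : R, 0 < h & forall Q' : S -> S -> R, stochastic Q' ->
    (forall x y, `|Q' x y - Q x y| < h) -> irreducible_stochastic Q'.
Proof.
move=> [[Q0 Q1] irr].
(* Zero entries are replaced by 1 so that the minimum over all pairs stays positive. *)
pose f (u : S * S) := if 0 < Q u.1 u.2 then Q u.1 u.2 else 1.
exists (\big[Order.min/1]_(u : S * S) f u).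
  elim/big_ind: _ => //; first by move=> a b a0 b0; rewrite lt_min a0 b0.
  by move=> u _; rewrite /f; case: ifP.
move=> Q' stQ' near; split=> // x y; have [n Qn] := irr x y; exists n.
apply: (kpow_gt0_sub (Q := Q)) => //; first exact: stQ'.1.
move=> a b ab; have := lt_le_trans (near a b) (bigmin_le_cond _ _ (j := (a, b)) isT).
rewrite /f /= ab ltr_norml => /andP[]; lra.
Qed.

(** * Outer probability and the weak law *)

(* convergence to 0 of the outer probability, so that measurability only has to be
   checked for the final event *)
Definition outer_vanish (R : realType) (d : measure_display)
    (T : measurableType d) (Pr : probability T R) (B : nat -> set T) : Prop :=
  forall eta : R, 0 < eta -> \forall n \near \oo,
    exists C, [/\ measurable C, B n `<=` C & (Pr C <= eta%:E)%E].

Lemma outer_vanish_sub (R : realType) (d : measure_display)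
    (T : measurableType d) (Pr : probability T R) (A B : nat -> set T) :
  (\forall n \near \oo, A n `<=` B n) -> outer_vanish Pr B -> outer_vanish Pr A.
Proof.
move=> AB vB eta eta0; apply: filterS2 AB (vB _ eta0) => n ABn [C [mC BC Ceta]].
by exists C; split => //; apply: subset_trans BC.
Qed.

Lemma outer_vanishU (R : realType) (d : measure_display)
    (T : measurableType d) (Pr : probability T R) (A B : nat -> set T) :
  outer_vanish Pr A -> outer_vanish Pr B -> outer_vanish Pr (fun n => A n `|` B n).
Proof.
move=> vA vB eta eta0; have eta20 : 0 < eta / 2 by rewrite divr_gt0.
apply: filterS2 (vA _ eta20) (vB _ eta20) => n [C [mC AC Ceta]] [D [mD BD Deta]].
exists (C `|` D); split; [exact: measurableU|exact: setUSS|].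
by rewrite (splitr eta) EFinD (le_trans (measureU2 _ _ _)) // leeD.
Qed.

Lemma outer_vanish0 (R : realType) (d : measure_display)
    (T : measurableType d) (Pr : probability T R) : outer_vanish Pr (fun=> set0).
Proof.
move=> eta eta0; apply: filterE => n; exists set0; split => //.
by rewrite measure0 lee_fin ltW.
Qed.

Lemma outer_vanish_exists (R : realType) (d : measure_display)
    (T : measurableType d) (Pr : probability T R) (I : finType)
    (B : I -> nat -> set T) :
  (forall i, outer_vanish Pr (B i)) ->
  outer_vanish Pr (fun n => [set w | exists i, B i n w]).
Proof.
move=> vB.
suff h (s : seq I) : outer_vanish Pr (fun n => [set w | exists2 i, i \in s & B i n w]).
  apply: outer_vanish_sub (h (enum I)); apply: filterE => n w [i Bi]; exists i => //.
  by rewrite mem_enum.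
elim: s => [|i s IH].
  by apply: outer_vanish_sub (outer_vanish0 Pr); apply: filterE => n w [].
apply: outer_vanish_sub (outer_vanishU (vB i) IH); apply: filterE => n w [j].
by rewrite inE => /predU1P[->|js] Bj; [left|right; exists j].
Qed.

Lemma cvg_outer_vanish (R : realType) (d : measure_display)
    (T : measurableType d) (Pr : probability T R) (B : nat -> set T) :
  (forall n, measurable (B n)) -> Pr (B n) @[n --> \oo] --> (0 : \bar R) ->
  outer_vanish Pr B.
Proof.
move=> mB /fine_cvgP[_ /cvgrPdist_le B0] eta eta0; apply: filterS (B0 _ eta0) => n.
rewrite sub0r normrN => /ler_normlP[_ Bn].
by exists (B n); split => //; rewrite -(fineK (fin_num_measure Pr _ (mB n))) lee_fin.
Qed.

Lemma outer_vanish_cvg (R : realType) (d : measure_display)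
    (T : measurableType d) (Pr : probability T R) (B : nat -> set T) :
  (forall n, measurable (B n)) -> outer_vanish Pr B ->
  Pr (B n) @[n --> \oo] --> (0 : \bar R).
Proof.
move=> mB vB; apply/fine_cvgP; split.
  by apply: filterE => n; exact: fin_num_measure.
apply/cvgrPdist_le => e e0; apply: filterS (vB _ e0) => n [C [mC BC Ce]].
rewrite sub0r normrN ger0_norm ?fine_ge0 //.
rewrite -lee_fin fineK ?fin_num_measure // (le_trans _ Ce) //.
by apply: le_measure => //; rewrite inE.
Qed.

Lemma bounded_integrable (R : realType) (d : measure_display)
    (T : measurableType d) (Pr : probability T R) (f : T -> R) (M : R) :
  measurable_fun setT f -> (forall w, `|f w| <= M) ->
  Pr.-integrable setT (EFin \o f).
Proof.
move=> mf fM; apply: measurable_bounded_integrable => //.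
  by rewrite ltey_eq fin_num_measure.
exists M; split; first exact: num_real.
by move=> r Mr w _ /=; rewrite (le_trans (fM w)) // ltW.
Qed.

Lemma Rintegral_indic (R : realType) (d : measure_display)
    (T : measurableType d) (Pr : probability T R) (A : set T) :
  measurable A -> \int[Pr]_w (\1_A w : R) = fine (Pr A).
Proof. by move=> mA; rewrite /Rintegral integral_indic // setIT. Qed.

Lemma measurable_norm_ge (R : realType) (d : measure_display)
    (T : measurableType d) (f : T -> R) (c : R) :
  measurable_fun setT f -> measurable [set w | c <= `|f w|].
Proof.
move=> mf; have mnf : measurable_fun setT (fun w => `|f w|).
  exact: measurableT_comp.
rewrite (_ : [set w | _] = setT `&` (fun w => `|f w|) @^-1` `[c, +oo[%classic).
  exact: mnf.
by rewrite setTI; apply/seteqP; split => w /=; rewrite in_itv /= andbT.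
Qed.

(** The two product hypotheses say that D_j = 1_(E j) - p 1_(H j) integrates to 0 against 1_(E i)
    and 1_(H i) for i < j. The D_j are therefore orthogonal and bounded by 1, their sum has second
    moment at most n, and Chebyshev's inequality bounds the probability by 1 / (n e^2). *)
Lemma weak_law (R : realType) (d : measure_display)
    (T : measurableType d) (Pr : probability T R) (E H : nat -> set T) (p : R) :
  0 <= p <= 1 -> (forall j, measurable (E j)) -> (forall j, measurable (H j)) ->
  (forall i j, (i < j)%N -> Pr (E i `&` E j) = (p%:E * Pr (E i `&` H j))%E) ->
  (forall i j, (i < j)%N -> Pr (H i `&` E j) = (p%:E * Pr (H i `&` H j))%E) ->
  forall e : R, 0 < e -> outer_vanish Pr (fun n => [set w |
    n%:R * e <= `|\sum_(j < n) (\1_(E j) w - p * \1_(H j) w)|]).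
Proof.
move=> /andP[p0 p1] mE mH EE HE e e0.
pose D j w : R := \1_(E j) w - p * \1_(H j) w.
pose Z n w : R := \sum_(j < n) D j w.
have mD j : measurable_fun setT (D j).
  by apply: measurable_funB => //; apply: measurable_funM.
have mZ n : measurable_fun setT (Z n) by exact: measurable_sum.
have D1 j w : `|D j w| <= 1.
  rewrite /D !indicE ler_norml; case: (_ \in _); case: (_ \in _) => /=; lra.
have Zn n w : `|Z n w| <= n%:R.
  rewrite -[n in n%:R]card_ord -sumr_const.
  by apply: le_trans (ler_norm_sum _ _ _) _; exact: ler_sum.
have iDD i j : Pr.-integrable setT (EFin \o (fun w => D i w * D j w)).
  apply: (@bounded_integrable _ _ _ _ _ 1); first exact: measurable_funM.
  by move=> w; rewrite normrM mulr_ile1.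
have iZD n j : Pr.-integrable setT (EFin \o (fun w => Z n w * D j w)).
  apply: (@bounded_integrable _ _ _ _ _ (n%:R * 1)); first exact: measurable_funM.
  by move=> w; rewrite normrM ler_pM.
have iZZ n : Pr.-integrable setT (EFin \o (fun w => Z n w * Z n w)).
  apply: (@bounded_integrable _ _ _ _ _ (n%:R * n%:R)); first exact: measurable_funM.
  by move=> w; rewrite normrM ler_pM.
have iD (f g : T -> R) : Pr.-integrable setT (EFin \o f) ->
    Pr.-integrable setT (EFin \o g) ->
    Pr.-integrable setT (EFin \o (fun w => f w + g w)).
  by move=> fi gi; exact: (integrableD measurableT fi gi).
have iB (f g : T -> R) : Pr.-integrable setT (EFin \o f) ->
    Pr.-integrable setT (EFin \o g) ->
    Pr.-integrable setT (EFin \o (fun w => f w - g w)).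
  by move=> fi gi; exact: (integrableB measurableT fi gi).
have iZ (c : R) (f : T -> R) : Pr.-integrable setT (EFin \o f) ->
    Pr.-integrable setT (EFin \o (fun w => c * f w)).
  by move=> fi; exact: (integrableZl measurableT c fi).
have ZS n w : Z n.+1 w = Z n w + D n w by rewrite /Z big_ord_recr.
have DD0 i j : (i < j)%N -> \int[Pr]_w (D i w * D j w) = 0.
  move=> ij.
  have iI A : measurable A -> Pr.-integrable setT (EFin \o (\1_A : T -> R)).
    exact: integrable_indic.
  have iI' A c : measurable A ->
      Pr.-integrable setT (EFin \o (fun w => c * (\1_A w : R))).
    by move=> mA; apply: iZ; exact: iI.
  have mI A B : measurable A -> measurable B -> measurable (A `&` B) by exact: measurableI.
  under eq_Rintegral => w _.
    (* Grouped this way, the first bracket integrates to 0 by [EE] and the second by [HE]. *)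
    rewrite (_ : D i w * D j w =
      (\1_(E i `&` E j) w - p * \1_(E i `&` H j) w) -
       p * (\1_(H i `&` E j) w - p * \1_(H i `&` H j) w)); last first.
      by rewrite /D !indicI /=; ring.
    over.
  have iB1 A B : measurable A -> measurable B -> Pr.-integrable setT (EFin \o (fun w =>
      \1_A w - p * \1_B w)).
    by move=> mA mB; apply: iB; [exact: iI|exact: iI'].
  rewrite RintegralB //; [|exact: iB1 (mI _ _ _ _ _ _) (mI _ _ _ _ _ _)|]; last first.
    by apply: iZ; apply: iB1; apply: mI.
  have int1 A B : measurable A -> measurable B ->
      \int[Pr]_w (\1_A w - p * \1_B w) = fine (Pr A) - p * fine (Pr B).
    move=> mA mB; rewrite RintegralB //; [|exact: iI|exact: iI'].
    by rewrite RintegralZl ?Rintegral_indic //; exact: iI.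
  rewrite RintegralZl //; last by apply: iB1; apply: mI.
  rewrite !int1; try by apply: mI.
  rewrite EE // HE // !fineM ?fin_num_measure //; try by apply: mI.
  by rewrite !subrr mulr0 subrr.
have ZD0 m j : (m <= j)%N -> \int[Pr]_w (Z m w * D j w) = 0.
  elim: m => [|m IH] mj.
    under eq_Rintegral do rewrite /Z big_ord0 mul0r.
    by rewrite Rintegral_cst // mul0r.
  under eq_Rintegral do rewrite ZS mulrDl.
  by rewrite RintegralD // IH ?(ltnW mj) // DD0 // addr0.
have DD1 j : \int[Pr]_w (D j w * D j w) <= 1.
  have <- : \int[Pr]_w (1 : R) = 1.
    rewrite Rintegral_cst // mul1r.
    by rewrite (_ : fine _ = fine (1 : \bar R)) //; congr fine; exact: probability_setT.
  apply: le_Rintegral => //.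
    by apply: (@bounded_integrable _ _ _ _ _ 1) => // w; rewrite normr1.
  by move=> w _; rewrite (le_trans (ler_norm _)) // normrM mulr_ile1.
have ZZn n : \int[Pr]_w (Z n w * Z n w) <= n%:R.
  elim: n => [|n IH].
    under eq_Rintegral do rewrite /Z big_ord0 mul0r.
    by rewrite Rintegral_cst // mul0r.
  under eq_Rintegral => w _.
    rewrite (_ : Z n.+1 w * Z n.+1 w =
      Z n w * Z n w + (Z n w * D n w + (Z n w * D n w + D n w * D n w))); last first.
      by rewrite ZS; ring.
    over.
  have iD2 := iD _ _ (iZD n n) (iDD n n).
  have iD3 := iD _ _ (iZD n n) iD2.
  rewrite !RintegralD // !ZD0 // !add0r -natr1 lerD //.
move=> eta eta0; near=> n.
set B := [set w | _].
have mB : measurable B.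
  exact: measurable_norm_ge (mZ n).
exists B; split => //; rewrite -(fineK (fin_num_measure Pr _ mB)) lee_fin.
have n0 : 0 < n%:R :> R by rewrite ltr0n; near: n; exists 1%N.
(* Chebyshev: (n e)^2 1_B <= Z_n^2 pointwise. *)
have : (n%:R * e) ^+ 2 * fine (Pr B) <= n%:R.
  apply: le_trans (ZZn n).
  rewrite -Rintegral_indic // -RintegralZl //; last exact: integrable_indic.
  apply: le_Rintegral => //.
    apply: (@bounded_integrable _ _ _ _ _ ((n%:R * e) ^+ 2 * 1)).
      exact: measurable_funM.
    move=> w; rewrite normrM ger0_norm ?sqr_ge0 // ler_wpM2l ?sqr_ge0 // indicE.
    by case: (_ \in _); rewrite ?normr1 ?normr0.
  move=> w _; rewrite indicE -expr2.
  case: (boolP (w \in B)) => [|_]; last by rewrite mulr0 sqr_ge0.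
  rewrite inE /B /= => nZ; rewrite mulr1 -[leRHS]real_normK ?num_real //.
  by rewrite ler_sqr // nnegrE // mulr_ge0 // ltW.
set m := fine (Pr B) => nm.
have ne : eta^-1 / e ^+ 2 <= n%:R by near: n; exact: nbhs_infty_ger.
have k0 : 0 < n%:R * e ^+ 2 by rewrite mulr_gt0 // exprn_gt0.
rewrite -(ler_pM2l k0); apply: (@le_trans _ _ 1).
  by rewrite -(ler_pM2l n0) mulr1 (le_trans _ nm) // exprMn expr2 !mulrA.
by move: ne; rewrite ler_pdivrMr ?exprn_gt0 // -div1r ler_pdivrMr.
Unshelve. all: by end_near. Qed.

(** * Quantile functions *)

Lemma lebesgue_stieltjes_itv_oc (R : realType) (G : cumulativeBounded (0 : R) 1)
    (a b : R) :
  a <= b -> lebesgue_stieltjes_measure G `]a, b]%classic = (G b - G a)%:E.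
Proof.
move=> ab; rewrite /lebesgue_stieltjes_measure /measure_extension/=.
rewrite measurable_mu_extE/= ?wlength_itv_bnd//; exact: is_ocitv.
Qed.

Lemma lebesgue_stieltjes_itv_Nyc (R : realType) (G : cumulativeBounded (0 : R) 1)
    (a : R) :
  lebesgue_stieltjes_measure G `]-oo, a]%classic = (G a)%:E.
Proof. by rewrite -cdf_lebesgue_stieltjes_id. Qed.

Lemma cumulativeBounded01 (R : realType) (G : cumulativeBounded (0 : R) 1) (a : R) :
  0 <= G a <= 1.
Proof.
rewrite -!lee_fin -lebesgue_stieltjes_itv_Nyc measure_ge0 /=.
exact: probability_le1.
Qed.

Lemma bounded_supportP (R : realType) (G : cumulativeBounded (0 : R) 1) :
  bounded_support G -> exists M : R, [/\ 0 < M, G (- M) = 0, G M = 1 &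
    lebesgue_stieltjes_measure G (~` `]- M, M]) = 0%E].
Proof.
(* Moving strictly beyond [M0] puts the whole ray up to -M outside the support interval, so G (- M)
   = 0 even if there is an atom at - M0. *)
move=> [M0 M0P]; pose M := `|M0| + 1.
have M0M : M0 < M by rewrite /M (le_lt_trans (ler_norm _)) // ltrDl.
have NM : - M < - M0 by rewrite ltrN2.
have sub A : measurable A -> A `<=` ~` `[- M0, M0] ->
    lebesgue_stieltjes_measure G A = 0%E.
  move=> mA AM; apply/eqP; rewrite eq_le measure_ge0 andbT -M0P.
  apply: le_measure; rewrite ?inE //; apply: measurableC; exact: measurable_itv.
exists M; split.
- by rewrite /M ltr_wpDl.
- have : (G (- M))%:E = 0%E :> \bar R; last by case.
  rewrite -lebesgue_stieltjes_itv_Nyc sub // => z /=; rewrite !in_itv /= => zM.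
  by apply/negP; rewrite negb_and -ltNge (le_lt_trans zM).
- have : (1 - (G M)%:E = 0 :> \bar R)%E; last first.
    by move=> /eqP; rewrite -EFinB eqe subr_eq0 => /eqP.
  rewrite -lebesgue_stieltjes_itv_Nyc -probability_setC //; apply: sub.
    exact: measurableC.
  move=> z /= /negP; rewrite !in_itv /= -ltNge => Mz.
  by apply/negP; rewrite negb_and -!ltNge (lt_trans M0M Mz) orbT.
- apply: sub; first exact: measurableC.
  move=> z /= /negP; rewrite !in_itv /= negb_and -leNgt -ltNge => zM.
  apply/negP; rewrite negb_and -!ltNge.
  by case/orP: zM => zM; [rewrite (le_lt_trans zM)|rewrite (lt_trans M0M zM) orbT].
Qed.

(** For v > 0 = G a, the point a is a lower bound of the level set, so [inf] takes no default
    value. *)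
Lemma quantile_le (R : realType) (G : cumulativeBounded (0 : R) 1) (v a z : R) :
  G a = 0 -> 0 < v -> v <= G z -> quantile G v <= z.
Proof.
move=> Ga v0 vz; apply: ge_inf => //; exists a => t /= vt.
rewrite leNgt; apply/negP => ta.
have : G t <= G a by apply: cumulative_is_nondecreasing; exact: ltW.
by rewrite Ga => /(lt_le_trans (lt_le_trans v0 vt)); rewrite ltxx.
Qed.

(** Here b makes the level set nonempty, and monotonicity of G makes z a lower bound of it. *)
Lemma quantile_ge (R : realType) (G : cumulativeBounded (0 : R) 1) (v b z : R) :
  G b = 1 -> v <= 1 -> G z < v -> z <= quantile G v.
Proof.
move=> Gb v1 zv; apply: lb_le_inf; first by exists b; rewrite /= Gb.
move=> t /= vt; rewrite leNgt; apply/negP => tz.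
have : G t <= G z by apply: cumulative_is_nondecreasing; exact: ltW.
by move=> /(le_trans vt); rewrite leNgt zv.
Qed.

(* At v = 0 this relies on the junk value inf setT = 0; thanks to it the step
   approximation of the quantile below holds at v = 0 too. *)
Lemma quantile_out (R : realType) (G : cumulativeBounded (0 : R) 1) (v : R) :
  v \notin `]0, 1] -> quantile G v = 0.
Proof.
rewrite in_itv /= negb_and -leNgt -ltNge => /orP[v0|v1].
  rewrite /quantile (_ : [set _ | _] = setT); last first.
    by apply/seteqP; split=> // z _ /=; case/andP: (cumulativeBounded01 G z) => /(le_trans v0).
  by apply: inf_out => -[_ [b /(_ (b - 1) I)]]; rewrite leNgt ltrBlDr ltrDl ltr01.
rewrite /quantile (_ : [set _ | _] = set0) ?inf0 //.
apply/seteqP; split=> // z /= vz; have /andP[_] := cumulativeBounded01 G z.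
by rewrite leNgt (lt_le_trans v1 vz).
Qed.

Lemma measurable_quantile (R : realType) (G : cumulativeBounded (0 : R) 1) :
  bounded_support G -> measurable_fun setT (quantile G).
Proof.
move=> /bounded_supportP[M [M0 GN GM _]].
(* The default value 0 outside ]0, 1] can break monotonicity. Replacing it by -M on the left and M
   on the right gives a nondecreasing g, and the indicator of ]0, 1] restores the zeros. *)
pose g v := if v <= 0 then - M else if v <= 1 then quantile G v else M.
have gM v : 0 < v -> v <= 1 -> - M <= quantile G v <= M.
  by move=> v0 v1; rewrite (quantile_ge GM) ?GN // (quantile_le GN) // GM.
have -> : quantile G = fun v => g v * \1_(`]0, 1]%classic) v.
  apply/funext => v; rewrite indicE /g.
  have [v01|v01] := boolP (v \in `]0, 1]).
    rewrite mem_set //= mulr1; move: v01; rewrite in_itv /= => /andP[v0 ->].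
    by rewrite leNgt v0.
  by rewrite (quantile_out G v01) memNset ?mulr0 //; apply/negP.
apply: measurable_funM => //; apply: nondecreasing_measurable => // u v uv.
rewrite /g; case: (leP v 0) => v0; first by rewrite (le_trans uv v0).
case: (leP u 0) => u0; case: (leP v 1) => v1.
- by case/andP: (gM v v0 v1).
- lra.
- rewrite (le_trans uv v1); apply: lb_le_inf; first by exists M; rewrite /= GM.
  move=> z /= vz; apply: (quantile_le GN) => //; exact: le_trans vz.
- by case: (leP u 1) => // u1; case/andP: (gM u u0 u1).
Qed.

(** The cells, possibly empty, partition ]c 0, c n], so a step function on them takes the
    coefficient of the one cell containing v. It serves both the grid of rewards z and its image
    under G, a grid of values v. *)
Lemma sum_itv_oc (R : realType) (a c : nat -> R) (n : nat) (v : R) :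
  {homo c : i j / (i <= j)%N >-> i <= j} ->
  (v \notin `]c 0, c n] ->
    \sum_(k < n) a k * \1_(`]c k, c k.+1]%classic) v = 0) /\
  (v \in `]c 0, c n] -> exists k, [/\ (k < n)%N, c k < v <= c k.+1 &
    \sum_(k < n) a k * \1_(`]c k, c k.+1]%classic) v = a k]).
Proof.
move=> c_nd; have indE k : \1_(`]c k, c k.+1]%classic) v = (c k < v <= c k.+1)%R%:R :> R.
  by rewrite indicE mem_setE in_itv.
split=> [v_out|].
  rewrite big1 // => k _; rewrite indE; apply/eqP; rewrite mulf_eq0 pnatr_eq0 eqb0.
  apply/orP; right; apply: contraNN v_out; rewrite in_itv /= => /andP[ckv vck].
  by rewrite (le_lt_trans (c_nd _ _ (leq0n k)) ckv) (le_trans vck) // c_nd.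
elim: n => [|n IH]; first by rewrite in_itv /= => /andP[/lt_le_trans h /h]; rewrite ltxx.
rewrite in_itv /= => /andP[cv vc]; rewrite big_ord_recr /= indE.
have [vn|nv] := leP v (c n).
  have [|k [kn kv ->]] := IH; first by rewrite in_itv /= cv.
  by exists k; rewrite mulr0 addr0 ltnS ltnW.
exists n; split; rewrite ?nv ?vc //= mulr1 big1 ?add0r // => k _.
rewrite indE; have -> : (v <= c k.+1) = false; last by rewrite andbF mulr0.
by apply/negbTE; rewrite -ltNge (le_lt_trans _ nv) // c_nd.
Qed.

(** The same coefficients approximate the quantile on cells of v and the identity on cells of z, and
    the length of a v-cell is the G-mass of the z-cell. This links the mean of G to the uniform law
    of V without a change of variables. *)
Lemma quantile_approx (R : realType) (G : cumulativeBounded (0 : R) 1) (e : R) :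
  bounded_support G -> 0 < e ->
  exists (n : nat) (a c : nat -> R),
  [/\ forall k, 0 <= c k <= 1, forall k, c k <= c k.+1,
      forall v, `|quantile G v - \sum_(k < n) a k * \1_(`]c k, c k.+1]%classic) v| <= e
    & `|\int[lebesgue_stieltjes_measure G]_z z - \sum_(k < n) a k * (c k.+1 - c k)| <= e].
Proof.
move=> /bounded_supportP[M [M0 GN GM nullM]] e0.
have [n nP] : exists n, M + M <= e * n.+1%:R.
  exists (Num.bound ((M + M) / e)); rewrite mulrC -ler_pdivrMr //.
  have /archi_boundP/ltW Mn : 0 <= (M + M) / e by rewrite divr_ge0 ?addr_ge0 // ltW.
  by apply: le_trans Mn _; rewrite ler_nat.
pose h := (M + M) / n.+1%:R.
have h0 : 0 < h by rewrite divr_gt0 ?addr_gt0.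
have he : h <= e by rewrite ler_pdivrMr.
pose t (k : nat) := - M + k%:R * h.
have tS k : t k.+1 = t k + h by rewrite /t -natr1; ring.
have t_nd : {homo t : i j / (i <= j)%N >-> i <= j}.
  by move=> i j ij; rewrite /t lerD2l ler_pM2r // ler_nat.
have t0 : t 0 = - M by rewrite /t mul0r addr0.
have tn : t n.+1 = M by rewrite /t /h mulrC divfK ?pnatr_eq0 //; ring.
have G_nd : {homo G : x y / x <= y} by exact: cumulative_is_nondecreasing.
have c_nd : {homo (fun k => G (t k)) : i j / (i <= j)%N >-> i <= j}.
  by move=> i j ij; apply/G_nd/t_nd.
(* The coefficient of a cell is its right endpoint, at distance at most the mesh h <= e from the
   points of the cell; the cuts in v are the values of G on the grid. *)
exists n.+1, (fun k => t k.+1), (fun k => G (t k)); split.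
- by move=> k; exact: cumulativeBounded01.
- by move=> k; apply/G_nd/t_nd.
- move=> v; have [out ins] := sum_itv_oc (fun k => t k.+1) n.+1 v c_nd.
  rewrite t0 GN tn GM in out ins.
  have [v01|v01] := boolP (v \in `]0, 1]); last first.
    by rewrite (quantile_out G v01) out // subrr normr0 ltW.
  have [k [_ /andP[kv vk] ->]] := ins v01.
  move: v01; rewrite in_itv /= => /andP[v0 v1].
  have q1 := quantile_ge GM v1 kv; have q2 := quantile_le GN v0 vk.
  by rewrite ler_norml; move: q2; rewrite tS; lra.
pose s z := \sum_(k < n.+1) t k.+1 * \1_(`]t k, t k.+1]%classic) z.
(* The identity is truncated to be bounded, hence integrable; it changes only on a null set. *)
pose f z : R := z * \1_(`]- M, M]%classic) z.
pose mu : probability (measurableTypeR R) R := lebesgue_stieltjes_measure G.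
have mf : measurable_fun setT f by apply: measurable_funM.
have ms : measurable_fun setT s.
  by apply: measurable_sum => k; apply: measurable_funM.
have fs z : `|f z - s z| <= e.
  have [out ins] := sum_itv_oc (fun k => t k.+1) n.+1 z t_nd.
  rewrite t0 tn in out ins; rewrite /f /s indicE mem_setE.
  have [zM|zM] := boolP (z \in `]-M, M]); last first.
    by rewrite out // mulr0 subrr normr0 ltW.
  have [k [_ /andP[kv vk] ->]] := ins zM.
  by rewrite mulr1 ler_norml; move: vk; rewrite tS; lra.
have fM z : `|f z| <= M.
  rewrite /f indicE mem_setE in_itv /=.
  case: (boolP (_ < z <= M)) => [/andP[? ?]|_]; last by rewrite mulr0 normr0 ltW.
  by rewrite mulr1 ler_norml; apply/andP; split; lra.
have fi : mu.-integrable setT (EFin \o f) by exact: (@bounded_integrable _ _ _ mu f M).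
have si : mu.-integrable setT (EFin \o s).
  apply: (@bounded_integrable _ _ _ mu s (M + e)) => // z.
  have -> : s z = f z - (f z - s z) by ring.
  by rewrite (le_trans (ler_normB _ _)) // lerD // fM.
have fE : \int[lebesgue_stieltjes_measure G]_z z = \int[mu]_z f z.
  rewrite /Rintegral; congr fine; apply: ae_eq_integral => //.
  - exact/measurable_EFinP.
  - exists (~` `]- M, M]%classic); split => //.
      exact: measurableC.
    move=> z /= /not_implyP[_ fz] zM; apply: fz.
    by rewrite /f indicE mem_set // mulr1.
have sE : \int[mu]_z s z = \sum_(k < n.+1) t k.+1 * (G (t k.+1) - G (t k)).
  have ii k : mu.-integrable setT (EFin \o (\1_(`]t k, t k.+1]%classic) : R -> R)).
    exact: integrable_indic.
  have tii k : mu.-integrable setT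
      (EFin \o (fun z => t k.+1 * \1_(`]t k, t k.+1]%classic) z)).
    exact: (integrableZl measurableT (t k.+1) (ii k)).
  have sumi m : mu.-integrable setT
      (EFin \o (fun z => \sum_(k < m) t k.+1 * \1_(`]t k, t k.+1]%classic) z)).
    elim: m => [|m IH].
      apply: (@bounded_integrable _ _ _ mu _ 0) => [|z].
        by apply: measurable_sum => k; apply: measurable_funM.
      by rewrite big_ord0 normr0.
    rewrite (_ : _ \o _ = (EFin \o (fun z => \sum_(k < m) t k.+1 * \1_(`]t k, t k.+1]%classic) z
      + t m.+1 * \1_(`]t m, t m.+1]%classic) z))).
      exact: (integrableD measurableT IH (tii m)).
    by apply/funext => z /=; rewrite big_ord_recr.
  rewrite /s; elim: n.+1 => [|m IH].
    by rewrite big_ord0; under eq_Rintegral do rewrite big_ord0; rewrite Rintegral_cst // mul0r.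
  under eq_Rintegral do rewrite big_ord_recr /=.
  rewrite big_ord_recr -IH RintegralD //; last exact: sumi.
  congr (_ + _); rewrite RintegralZl; [|exact: measurableT|exact: ii].
  rewrite Rintegral_indic //=; congr (_ * _).
  by rewrite [X in fine X](lebesgue_stieltjes_itv_oc G) // t_nd.
rewrite fE -sE -RintegralB //.
apply: le_trans (le_normr_Rintegral _ _) _ => //.
  exact: (integrableB measurableT fi si).
have ci : mu.-integrable setT (EFin \o cst e).
  by apply: (@bounded_integrable _ _ _ mu _ e) => // z; rewrite ger0_norm // ltW.
have -> : e = \int[mu]_z e.
  rewrite Rintegral_cst //.
  by rewrite (_ : fine _ = fine (1 : \bar R)) ?mulr1 //; congr fine; exact: probability_setT.
apply: le_Rintegral => //.
  exact: integrable_norm (integrableB measurableT fi si).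
Qed.

(** * The controlled process *)

Lemma sigma_algebra_setI (T : Type) (G : set (set T)) (A B : set T) :
  sigma_algebra setT G -> G A -> G B -> G (A `&` B).
Proof.
move=> [G0 GC GU] GA GB.
have -> : A `&` B = setT `\` \bigcup_i bigcup2 (setT `\` A) (setT `\` B) i.
  by rewrite bigcup2E !setTD setCU !setCK.
by apply/GC/GU => -[|[|i]] /=; [exact: GC|exact: GC|exact: G0].
Qed.

Lemma filtration_sigma_algebra (R : realType) (S : finType) (T : Type)
    (X : nat -> T -> S) (U V : nat -> T -> R) (n : nat) :
  sigma_algebra setT (filtration X U V n).
Proof. exact: smallest_sigma_algebra. Qed.

Lemma filtration_mono (R : realType) (S : finType) (T : Type)
    (X : nat -> T -> S) (U V : nat -> T -> R) (m n : nat) :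
  (m <= n)%N -> filtration X U V m `<=` filtration X U V n.
Proof.
move=> mn; apply: sub_sigma_algebra2 => E [j jm EP]; exists j => //.
exact: leq_trans mn.
Qed.

Lemma filtrationI (R : realType) (S : finType) (T : Type)
    (X : nat -> T -> S) (U V : nat -> T -> R) (n : nat) (A B : set T) :
  filtration X U V n A -> filtration X U V n B -> filtration X U V n (A `&` B).
Proof. exact: sigma_algebra_setI (@filtration_sigma_algebra R S T X U V n). Qed.

Lemma filtration_state (R : realType) (S : finType) (T : Type)
    (X : nat -> T -> S) (U V : nat -> T -> R) (n : nat) (x : S) :
  filtration X U V n (X n @^-1` [set x]).
Proof. by apply: sub_sigma_algebra; exists n => //; constructor 1; exists x. Qed.

Lemma filtration_V (R : realType) (S : finType) (T : Type)
    (X : nat -> T -> S) (U V : nat -> T -> R) (n : nat) (B : set R) :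
  measurable B -> filtration X U V n (V n @^-1` B).
Proof. by move=> mB; apply: sub_sigma_algebra; exists n => //; constructor 3; exists B. Qed.

Definition visit (S : finType) (T : Type) (X : nat -> T -> S)
    (A : nat -> T -> 'I_2) (l : 'I_2) (x : S) (j : nat) : set T :=
  X j @^-1` [set x] `&` A j @^-1` [set l].

(** In [weak_law], [visit] plays the role of H, known at time j, and [move_event] that of E, known
    at time j + 1. *)
Definition move_event (R : realType) (S : finType) (T : Type) (X : nat -> T -> S)
    (V : nat -> T -> R) (A : nat -> T -> 'I_2) (l : 'I_2) (x y : S) (C : set R)
    (j : nat) : set T :=
  visit X A l x j `&` (X j.+1 @^-1` [set y] `&` V j.+1 @^-1` C).

Lemma indic_visit (R : realType) (S : finType) (T : Type) (X : nat -> T -> S)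
    (A : nat -> T -> 'I_2) (l : 'I_2) (x : S) (j : nat) (w : T) :
  \1_(visit X A l x j) w = ((X j w == x) && (A j w == l))%:R :> R.
Proof.
rewrite indicE; congr (nat_of_bool _)%:R; apply/idP/idP.
  by rewrite inE => -[/= -> ->]; rewrite !eqxx.
by move=> /andP[/eqP Xx /eqP Al]; rewrite inE.
Qed.

Lemma indic_move (R : realType) (S : finType) (T : Type) (X : nat -> T -> S)
    (V : nat -> T -> R) (A : nat -> T -> 'I_2) (l : 'I_2) (x y : S) (C : set R)
    (j : nat) (w : T) :
  \1_(move_event X V A l x y C j) w =
  ((X j w == x) && (A j w == l))%:R * ((X j.+1 w == y)%:R * \1_C (V j.+1 w)) :> R.
Proof.
rewrite /move_event indicI /= indic_visit indicI /=; congr (_ * (_ * _)).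
rewrite indicE; congr (nat_of_bool _)%:R; apply/idP/eqP; by rewrite inE.
Qed.

Lemma sum_visit (R : realType) (S : finType) (T : Type) (X : nat -> T -> S)
    (A : nat -> T -> 'I_2) (l : 'I_2) (x : S) (n : nat) (w : T) :
  \sum_(j < n) \1_(visit X A l x j) w = (visits X A n l x w)%:R :> R.
Proof. by rewrite /visits natr_sum; apply: eq_bigr => j _; rewrite indic_visit. Qed.

Lemma filtration_measurable (R : realType) (S : finType) (d : measure_display)
    (T : measurableType d) (Pr : probability T R) (P : 'I_2 -> S -> S -> R)
    (X : nat -> T -> S) (U V : nat -> T -> R) (A : nat -> T -> 'I_2) (n : nat) :
  controlled_process Pr P X U V A -> filtration X U V n `<=` measurable.
Proof.
move=> hA; apply: smallest_sub; first exact: sigma_algebra_measurable.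
move=> E [j _ [[x ->]|[B mB ->]|[B mB ->]]].
- exact: cp_X_measurable hA _ _.
- by rewrite -[_ @^-1` _]setTI; apply: (cp_U_measurable hA j).
- by rewrite -[_ @^-1` _]setTI; apply: (cp_V_measurable hA j).
Qed.

Lemma filtration_visit (R : realType) (S : finType) (d : measure_display)
    (T : measurableType d) (Pr : probability T R) (P : 'I_2 -> S -> S -> R)
    (X : nat -> T -> S) (U V : nat -> T -> R) (A : nat -> T -> 'I_2) (l : 'I_2)
    (x : S) (j : nat) :
  controlled_process Pr P X U V A -> filtration X U V j (visit X A l x j).
Proof.
move=> hA; apply: filtrationI; first exact: filtration_state.
exact: (cp_policy hA).
Qed.

Lemma filtration_move (R : realType) (S : finType) (d : measure_display)
    (T : measurableType d) (Pr : probability T R) (P : 'I_2 -> S -> S -> R)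
    (X : nat -> T -> S) (U V : nat -> T -> R) (A : nat -> T -> 'I_2) (l : 'I_2)
    (x y : S) (C : set R) (j : nat) :
  controlled_process Pr P X U V A -> measurable C ->
  filtration X U V j.+1 (move_event X V A l x y C j).
Proof.
move=> hA mC; apply: filtrationI.
  by apply: (filtration_mono (leqnSn j)); exact: filtration_visit hA.
by apply: filtrationI; [exact: filtration_state|exact: filtration_V].
Qed.

(** On D intersected with the visit, an event known at time j, the conditional probability is the
    constant P(l,x,y) m, so integrating it gives the product. *)
Lemma conditional_move (R : realType) (S : finType) (d : measure_display)
    (T : measurableType d) (Pr : probability T R) (P : 'I_2 -> S -> S -> R)
    (X : nat -> T -> S) (U V : nat -> T -> R) (A : nat -> T -> 'I_2) (l : 'I_2)
    (x y : S) (C : set R) (m : R) (j : nat) (D : set T) :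
  controlled_process Pr P X U V A ->
  measurable C -> C `<=` `[0, 1] -> lebesgue_measure C = m%:E ->
  filtration X U V j D ->
  Pr (D `&` move_event X V A l x y C j) =
    ((P l x y * m)%:E * Pr (D `&` visit X A l x j))%E.
Proof.
move=> hA mC C01 Cm jD.
have [_ /(_ (D `&` visit X A l x j))] :=
  cp_transition hA j y (measurable_itv `[0, 1]) (@subset_refl _ _) mC C01.
have jDv : filtration X U V j (D `&` visit X A l x j).
  by apply: filtrationI => //; exact: filtration_visit hA.
move=> /(_ jDv) condE.
(* The transition law also constrains U; the constraint to [0, 1] always holds and has measure 1. *)
have -> : D `&` move_event X V A l x y C j =
    X j.+1 @^-1` [set y] `&` U j.+1 @^-1` `[0, 1] `&` V j.+1 @^-1` C `&`
    (D `&` visit X A l x j).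
  apply/seteqP; split=> w; rewrite /move_event /=.
    move=> [Dw [vw [Xw Vw]]]; split=> //; split=> //; split=> //.
    by rewrite in_itv /=; exact: cp_U_01 hA _ _.
  by move=> [[[Xw _] Vw] [Dw vw]].
rewrite condE (eq_integral (cst (P l x y * m)%:E)); last first.
  move=> w; rewrite inE => -[_ [/= -> ->]].
  by rewrite lebesgue_measure_itv /= lte_fin ltr01 oppr0 adde0 mule1 Cm.
rewrite integral_cst //; exact: (filtration_measurable hA jDv).
Qed.

Lemma process_weak_law (R : realType) (S : finType) (d : measure_display)
    (T : measurableType d) (Pr : probability T R) (P : 'I_2 -> S -> S -> R)
    (X : nat -> T -> S) (U V : nat -> T -> R) (A : nat -> T -> 'I_2) (l : 'I_2)
    (x y : S) (C : set R) (m e : R) :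
  (forall l, stochastic (P l)) -> controlled_process Pr P X U V A ->
  measurable C -> C `<=` `[0, 1] -> lebesgue_measure C = m%:E -> 0 < e ->
  outer_vanish Pr (fun n => [set w | n%:R * e <=
    `|\sum_(j < n) \1_(move_event X V A l x y C j) w
      - P l x y * m * (visits X A n l x w)%:R| ]).
Proof.
move=> stP hA mC C01 Cm e0.
have [P0 P1] := stP l.
have Pxy1 : P l x y <= 1.
  by rewrite -(P1 x) (bigD1 y) //= lerDl sumr_ge0.
have m0 : 0 <= m by rewrite -lee_fin -Cm.
have m1 : m <= 1.
  rewrite -lee_fin -Cm (@le_trans _ _ (lebesgue_measure `[0%R, 1%R]%classic)) //.
    by apply: le_measure; rewrite ?inE //; exact: (measurable_itv `[0, 1]).
  by rewrite lebesgue_measure_itv /= lte_fin ltr01 oppr0 adde0.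
have fE j : filtration X U V j.+1 (move_event X V A l x y C j).
  exact: filtration_move hA mC.
have fH j : filtration X U V j (visit X A l x j) by exact: filtration_visit hA.
have P01 : 0 <= P l x y * m <= 1 by rewrite mulr_ge0 // mulr_ile1.
have mE j := filtration_measurable hA (fE j).
have mH j := filtration_measurable hA (fH j).
(* The move started at time i is known at time i + 1, so i < j is exactly what places it in the past
   of time j. *)
have EE i j : (i < j)%N -> Pr (move_event X V A l x y C i `&` move_event X V A l x y C j)
    = ((P l x y * m)%:E * Pr (move_event X V A l x y C i `&` visit X A l x j))%E.
  move=> ij; apply: (conditional_move _ _ _ hA mC C01 Cm).
  by apply: (filtration_mono ij); exact: fE.
have HE i j : (i < j)%N -> Pr (visit X A l x i `&` move_event X V A l x y C j)
    = ((P l x y * m)%:E * Pr (visit X A l x i `&` visit X A l x j))%E.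
  move=> ij; apply: (conditional_move _ _ _ hA mC C01 Cm).
  by apply: (filtration_mono (ltnW ij)); exact: fH.
apply: outer_vanish_sub (weak_law P01 mE mH EE HE e0).
by apply: filterE => n w /=; rewrite sumrB -mulr_sumr sum_visit.
Qed.

(** * Linear growth of the visit counts, and convergence of the transition and reward estimates *)

Lemma measurable_visits (R : realType) (S : finType) (d : measure_display)
    (T : measurableType d) (Pr : probability T R) (P : 'I_2 -> S -> S -> R)
    (X : nat -> T -> S) (U V : nat -> T -> R) (A : nat -> T -> 'I_2) (l : 'I_2)
    (x : S) (n : nat) :
  controlled_process Pr P X U V A ->
  measurable_fun setT (fun w => (visits X A n l x w)%:R : R).
Proof.
move=> hA; under eq_fun do rewrite -sum_visit.
apply: measurable_sum => j; apply: measurable_indic.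
by apply: (filtration_measurable hA (n := j)); exact: filtration_visit hA.
Qed.

(** The limit gamma is positive almost surely but may come arbitrarily close to 0, so c depends on
    eta: the events gamma <= 1/(m+1) decrease to a null event, and one of them has probability at
    most eta / 2. *)
Lemma visits_linear (R : realType) (S : finType) (d : measure_display)
    (T : measurableType d) (Pr : probability T R) (P : 'I_2 -> S -> S -> R)
    (X : nat -> T -> S) (U V : nat -> T -> R) (A : nat -> T -> 'I_2)
    (gamma : 'I_2 -> S -> {RV Pr >-> R}) (l : 'I_2) (x : S) (eta : R) :
  controlled_process Pr P X U V A -> TAR Pr X A gamma ->
  {ae Pr, forall w, forall l x, 0 < gamma l x w} -> 0 < eta ->
  exists2 c : R, 0 < c & \forall n \near \oo, exists C : set T, [/\ measurable C,
    [set w | (visits X A n l x w)%:R < c * n%:R] `<=` C & (Pr C <= eta%:E)%E].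
Proof.
move=> hA hTAR hgamma eta0; have eta20 : 0 < eta / 2 by rewrite divr_gt0.
pose B m := [set w | gamma l x w <= m.+1%:R^-1].
have mB m : measurable (B m).
  rewrite (_ : B m = setT `&` gamma l x @^-1` `]-oo, m.+1%:R^-1]%classic).
    exact: (measurable_funP (gamma l x)).
  by rewrite setTI; apply/seteqP; split => w /=; rewrite in_itv.
have capB : Pr (\bigcap_m B m) = 0%E.
  apply/negligibleP; first exact: bigcapT_measurable.
  apply: negligibleS hgamma => w Bw /= /(_ l x) g0.
  have /= := Bw (Num.bound (gamma l x w)^-1) I.
  apply/negP; rewrite -ltNge -[ltRHS]invrK ltf_pV2 ?posrE ?invr_gt0 //.
  have /archi_boundP/lt_le_trans : 0 <= (gamma l x w)^-1 by rewrite invr_ge0 ltW.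
  by apply; rewrite ler_nat.
have cvB : Pr (B m) @[m --> \oo] --> (0 : \bar R).
  rewrite -capB; apply: nonincreasing_cvg_mu => //.
  - by rewrite ltey_eq fin_num_measure.
  - exact: bigcapT_measurable.
  - move=> i j ij; apply/subsetPset => w /= /le_trans; apply.
    by rewrite lef_pV2 ?posrE // ler_nat ltnS.
have [m mP] : exists m, (Pr (B m) <= (eta / 2)%:E)%E.
  have [N _ /(_ N (leqnn N)) [C [mC BC Ce]]] := cvg_outer_vanish mB cvB eta20.
  by exists N; rewrite (le_trans _ Ce) //; apply: le_measure; rewrite ?inE.
(* With gamma > 2 c, a visit frequency below c deviates from gamma by at least c, which the TAR
   property makes unlikely. *)
pose c : R := m.+1%:R^-1 / 2.
have c0 : 0 < c by rewrite divr_gt0 // invr_gt0.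
exists c => //.
have mY n : measurable_fun setT (fun w => n%:R^-1 * (visits X A n l x w)%:R - gamma l x w).
  by apply: measurable_funB => //; apply: measurable_funM => //; exact: measurable_visits hA.
have := cvg_outer_vanish (fun n => measurable_norm_ge c (mY n)) (hTAR l x c c0).
move=> /(_ _ eta20); apply: filterS2 (nbhs_infty_gt 0) => n n0 [C [mC YC Ceta]].
exists (B m `|` C); split; first exact: measurableU.
  move=> w /= vcn; have vc : n%:R^-1 * (visits X A n l x w)%:R < c.
    by rewrite mulrC ltr_pdivrMr ?ltr0n.
  have [gB|Bg] := leP (gamma l x w) m.+1%:R^-1; first by left.
  right; apply: YC => /=; rewrite ler_normr; apply/orP; right.
  rewrite opprB lerBrDr; move: vc Bg; rewrite /c.
  set k := _.+1%:R^-1; set u := _ * (visits _ _ _ _ _ _)%:R; lra.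
by rewrite (splitr eta) EFinD (le_trans (measureU2 _ _ _)) // leeD.
Qed.

(** Passes from o(n) to o(visits): where visits >= c n, the event forces |Y n| >= n (c e). As c
    depends on eta, eta is fixed first. *)
Lemma vanish_visits (R : realType) (S : finType) (d : measure_display)
    (T : measurableType d) (Pr : probability T R) (P : 'I_2 -> S -> S -> R)
    (X : nat -> T -> S) (U V : nat -> T -> R) (A : nat -> T -> 'I_2)
    (gamma : 'I_2 -> S -> {RV Pr >-> R}) (l : 'I_2) (x : S) (Y : nat -> T -> R) :
  controlled_process Pr P X U V A -> TAR Pr X A gamma ->
  {ae Pr, forall w, forall l x, 0 < gamma l x w} ->
  (forall e : R, 0 < e -> outer_vanish Pr (fun n => [set w | n%:R * e <= `|Y n w| ])) ->
  forall e : R, 0 < e -> outer_vanish Pr (fun n =>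
    [set w | (visits X A n l x w)%:R * e <= `|Y n w| ]).
Proof.
move=> hA hTAR hgamma vY e e0 eta eta0; have eta20 : 0 < eta / 2 by rewrite divr_gt0.
have [c c0 vc] := visits_linear l x hA hTAR hgamma eta20.
have ce0 : 0 < c * e by rewrite mulr_gt0.
apply: filterS2 vc (vY _ ce0 _ eta20) => n [C [mC vC Ceta]] [D [mD YD Deta]].
exists (C `|` D); split; first exact: measurableU.
  move=> w /= vY'; have [nv|vn] := leP (c * n%:R) (visits X A n l x w)%:R.
    right; apply: YD => /=; rewrite mulrA (le_trans _ vY') // ler_pM2r //.
    by rewrite mulrC.
  by left; apply: vC.
by rewrite (splitr eta) EFinD (le_trans (measureU2 _ _ _)) // leeD.
Qed.

(** Case Y = 0 of [vanish_visits]: n e <= 0 fails for n > 0, while visits <= 0 is the event in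
    question. *)
Lemma vanish_unvisited (R : realType) (S : finType) (d : measure_display)
    (T : measurableType d) (Pr : probability T R) (P : 'I_2 -> S -> S -> R)
    (X : nat -> T -> S) (U V : nat -> T -> R) (A : nat -> T -> 'I_2)
    (gamma : 'I_2 -> S -> {RV Pr >-> R}) (l : 'I_2) (x : S) :
  controlled_process Pr P X U V A -> TAR Pr X A gamma ->
  {ae Pr, forall w, forall l x, 0 < gamma l x w} ->
  outer_vanish Pr (fun n => [set w | visits X A n l x w = 0%N]).
Proof.
move=> hA hTAR hgamma.
have v0 (e : R) : 0 < e -> outer_vanish Pr
    (fun n => [set w | n%:R * e <= `|(fun _ _ => 0 : R) n w| ]).
  move=> e0; apply: outer_vanish_sub (outer_vanish0 Pr).
  apply: filterS (nbhs_infty_gt 0) => n n0 w /=.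
  by rewrite normr0 leNgt mulr_gt0 // ltr0n.
apply: outer_vanish_sub (vanish_visits l x hA hTAR hgamma v0 ltr01).
by apply: filterE => n w /= ->; rewrite mul0r normr0.
Qed.

Lemma Phat_vanish (R : realType) (S : finType) (d : measure_display)
    (T : measurableType d) (Pr : probability T R) (P : 'I_2 -> S -> S -> R)
    (X : nat -> T -> S) (U V : nat -> T -> R) (A : nat -> T -> 'I_2)
    (gamma : 'I_2 -> S -> {RV Pr >-> R}) (l : 'I_2) (x y : S) (e : R) :
  (forall l, stochastic (P l)) ->
  controlled_process Pr P X U V A -> TAR Pr X A gamma ->
  {ae Pr, forall w, forall l x, 0 < gamma l x w} -> 0 < e ->
  outer_vanish Pr (fun n => [set w | e <= `|Phat R X A n l w x y - P l x y| ]).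
Proof.
move=> stP hA hTAR hgamma e0.
have I1 : lebesgue_measure `[0 : R, 1]%classic = (1 : R)%:E.
  by rewrite lebesgue_measure_itv /= lte_fin ltr01 oppr0 adde0.
have vY := fun e' e'0 => @process_weak_law R S d T Pr P X U V A l x y _ 1 e' stP hA
  (measurable_itv `[0, 1]) (@subset_refl _ _) I1 e'0.
(* Removing the unvisited case turns the denominator [maxn _ 1] into the visit count itself. *)
apply: outer_vanish_sub (outer_vanishU (vanish_unvisited l x hA hTAR hgamma)
  (vanish_visits l x hA hTAR hgamma vY e0)).
apply: filterE => n w /= ePP; have [v0|v0] := posnP (visits X A n l x w); [by left|right].
rewrite /Phat (maxn_idPl v0) in ePP.
have vR : 0 < (visits X A n l x w)%:R :> R by rewrite ltr0n.
have -> : \sum_(j < n) \1_(move_event X V A l x y `[0, 1]%classic j) w =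
    (\sum_(j < n) [&& X j w == x, A j w == l & X j.+1 w == y])%N%:R :> R.
  rewrite natr_sum; apply: eq_bigr => j _; rewrite indic_move indicE mem_set.
    by rewrite mulr1 -natrM mulnb andbA.
  by rewrite /= in_itv /=; exact: cp_V_01 hA _ _.
rewrite mulr1; set N := (\sum_(_ < _) _)%N in ePP *; set v := visits _ _ _ _ _ _ in ePP vR *.
have -> : N%:R - P l x y * v%:R = v%:R * (N%:R / v%:R - P l x y).
  by rewrite mulrBr mulrCA divff ?mulr1 ?gt_eqF // mulrC.
by rewrite normrM gtr0_norm // ler_pM2l.
Qed.

(** Splitting by the next state replaces the random indices of [F] by fixed ones, leaving a
    deterministic function of V; both the approximation of rewards and their measurability rest on
    this. *)
Lemma visit_reward (R : realType) (S : finType) (T : Type)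
    (F : 'I_2 -> S -> S -> cumulativeBounded (0 : R) 1) (X : nat -> T -> S)
    (V : nat -> T -> R) (A : nat -> T -> 'I_2) (l : 'I_2) (x : S) (j : nat) (w : T) :
  ((X j w == x) && (A j w == l))%:R * reward F X V A j.+1 w =
  \sum_y ((X j w == x) && (A j w == l))%:R *
    ((X j.+1 w == y)%:R * quantile (F l x y) (V j.+1 w)).
Proof.
have [/andP[/eqP Xx /eqP Al]|_] := boolP (_ && _); last first.
  by rewrite mul0r big1 // => y _; rewrite mul0r.
rewrite mul1r (bigD1 (X j.+1 w)) //= eqxx !mul1r big1 ?addr0 => [|y]; last first.
  by rewrite eq_sym => /negPf ->; rewrite mul0r mulr0.
by rewrite /reward /= Xx Al.
Qed.

(** Three errors of at most e / 4 each, so strictly less than e together: quantiles against step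
    functions (W to Q), the weak law on each cell (Q to Z v), and the step means against the true
    means (Z to the expected reward). *)
Lemma reward_vanish (R : realType) (S : finType) (d : measure_display)
    (T : measurableType d) (Pr : probability T R) (P : 'I_2 -> S -> S -> R)
    (F : 'I_2 -> S -> S -> cumulativeBounded (0 : R) 1)
    (X : nat -> T -> S) (U V : nat -> T -> R) (A : nat -> T -> 'I_2)
    (gamma : 'I_2 -> S -> {RV Pr >-> R}) (l : 'I_2) (x : S) (e : R) :
  (forall l, stochastic (P l)) -> (forall l x y, bounded_support (F l x y)) ->
  controlled_process Pr P X U V A -> TAR Pr X A gamma ->
  {ae Pr, forall w, forall l x, 0 < gamma l x w} -> 0 < e ->
  outer_vanish Pr (fun n => [set w | e <=
    `|(\sum_(j < n) ((X j w == x) && (A j w == l))%:R * reward F X V A j.+1 w)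
      / (maxn (visits X A n l x w) 1)%:R - exp_reward P F l x| ]).
Proof.
move=> stP hF hA hTAR hgamma e0.
have e40 : 0 < e / 4 by rewrite divr_gt0.
have /choice[z zP] : forall y, exists z : nat * (nat -> R) * (nat -> R),
    [/\ forall k, 0 <= z.2 k <= 1, forall k, z.2 k <= z.2 k.+1,
      forall v, `|quantile (F l x y) v -
        \sum_(k < z.1.1) z.1.2 k * \1_(`]z.2 k, z.2 k.+1]%classic) v| <= e / 4
    & `|\int[lebesgue_stieltjes_measure (F l x y)]_z z -
        \sum_(k < z.1.1) z.1.2 k * (z.2 k.+1 - z.2 k)| <= e / 4].
  move=> y; have [n [a [c ?]]] := quantile_approx (hF l x y) e40.
  by exists (n, a, c).
pose K y := (z y).1.1; pose a y := (z y).1.2; pose c y := (z y).2.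
pose C y k : set R := `]c y k, c y k.+1]%classic.
have mC y k : lebesgue_measure (C y k) = (c y k.+1 - c y k)%:E.
  have [_ /(_ k) cc _ _] := zP y; move: cc; rewrite -/(c y) => cc.
  (* Cuts may coincide where the distribution function is flat; the cell is then empty and its
     length is 0. *)
  rewrite /C lebesgue_measure_itv /= lte_fin; case: ltP => // cc'.
  have -> : c y k.+1 = c y k by apply/eqP; rewrite eq_le cc cc'.
  by rewrite subrr.
have C01 y k : C y k `<=` `[0, 1].
  have [c01 _ _ _] := zP y; rewrite -/(c y) in c01.
  move=> v; rewrite /C /= !in_itv /= => /andP[cv vc].
  have /andP[ck _] := c01 k; have /andP[_ ck1] := c01 k.+1.
  by rewrite (le_trans vc ck1) (le_trans ck (ltW cv)).
pose N y k n w : R := \sum_(j < n) \1_(move_event X V A l x y (C y k) j) w.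
pose m y k := c y k.+1 - c y k.
pose Y y k n w := N y k n w - P l x y * m y k * (visits X A n l x w)%:R.
pose B := \sum_y \sum_(k < K y) `|a y k|.
have B0 : 0 <= B by apply: sumr_ge0 => y _; apply: sumr_ge0.
(* Chosen so that the cell errors, weighted by coefficients of total size B, add up to at most e /
   4; B + 1 avoids dividing by 0. *)
pose e' := e / 4 / (B + 1).
have e'0 : 0 < e' by rewrite divr_gt0 // ltr_wpDl.
have vY y k := vanish_visits l x hA hTAR hgamma (fun e2 e20 =>
  process_weak_law l x y stP hA (measurable_itv _) (@C01 y k) (mC y k) e20) e'0.
apply: outer_vanish_sub (outer_vanishU (vanish_unvisited l x hA hTAR hgamma)
  (outer_vanish_exists (fun y => outer_vanish_exists (fun k : 'I_(K y) => vY y k)))).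
apply: filterE => n w /= ePP; have [v0|v0] := posnP (visits X A n l x w); [by left|right].
apply: contrapT => /= noY.
have Ysmall y (k : 'I_(K y)) : `|Y y k n w| <= (visits X A n l x w)%:R * e'.
  by rewrite leNgt; apply/negP => /ltW ?; apply: noY; exists y, k.
have vR : 0 < (visits X A n l x w)%:R :> R by rewrite ltr0n.
rewrite (maxn_idPl v0) in ePP.
set v : R := (visits X A n l x w)%:R in Ysmall vR ePP.
have [P0 P1] := stP l.
pose H j : R := ((X j w == x) && (A j w == l))%:R.
have H0 j : 0 <= H j by exact: ler0n.
have vE : v = \sum_(j < n) H j.
  by rewrite /v -sum_visit; apply: eq_bigr => j _; rewrite indic_visit.
set W := \sum_(j < n) _ in ePP.
pose Q := \sum_y \sum_(k < K y) a y k * N y k n w.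
have WQ : `|W - Q| <= e / 4 * v.
  rewrite vE mulr_sumr.
  have -> : Q = \sum_(j < n) H j * \sum_y (X j.+1 w == y)%:R *
      \sum_(k < K y) a y k * \1_(C y k) (V j.+1 w).
    rewrite /Q /N; under eq_bigr do under eq_bigr do rewrite mulr_sumr.
    under eq_bigr do rewrite exchange_big /=.
    rewrite exchange_big /=; apply: eq_bigr => j _; rewrite mulr_sumr.
    apply: eq_bigr => y _; rewrite !mulr_sumr; apply: eq_bigr => k _.
    by rewrite indic_move /H; ring.
  rewrite -sumrB; apply: le_trans (ler_norm_sum _ _ _) _; apply: ler_sum => j _.
  (* In the sum over y only the actual next state contributes, so each visit costs a single
     approximation error. *)
  rewrite visit_reward -mulr_sumr -/(H j) -mulrBr normrM ger0_norm //.
  rewrite [leRHS]mulrC ler_wpM2l // -sumrB (bigD1 (X j.+1 w)) //=.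
  rewrite [X in _ + X]big1 => [|y]; last first.
    by rewrite eq_sym => /negPf ->; rewrite !mul0r subrr.
  by rewrite eqxx !mul1r addr0; have [_ _ + _] := zP (X j.+1 w); apply.
pose Z := \sum_y P l x y * \sum_(k < K y) a y k * m y k.
have QZ : `|Q - Z * v| <= e / 4 * v.
  have -> : Q - Z * v = \sum_y \sum_(k < K y) a y k * Y y k n w.
    rewrite /Q /Z mulr_suml -sumrB; apply: eq_bigr => y _.
    rewrite mulr_sumr mulr_suml -sumrB; apply: eq_bigr => k _.
    by rewrite /Y -/v; ring.
  apply: (@le_trans _ _ (B * (v * e'))).
    rewrite /B mulr_suml; apply: le_trans (ler_norm_sum _ _ _) _; apply: ler_sum => y _.
    rewrite mulr_suml; apply: le_trans (ler_norm_sum _ _ _) _; apply: ler_sum => k _.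
    by rewrite normrM ler_wpM2l.
  rewrite mulrCA mulrC ler_pM2r // /e' mulrA ler_pdivrMr ?ltr_wpDl //.
  by rewrite mulrC ler_pM2l // lerDl.
have Zr : `|Z - exp_reward P F l x| <= e / 4.
  rewrite /Z /exp_reward -sumrB; apply: le_trans (ler_norm_sum _ _ _) _.
  rewrite [leRHS](_ : _ = \sum_y P l x y * (e / 4)); last by rewrite -mulr_suml P1 mul1r.
  apply: ler_sum => y _.
  rewrite -mulrBr normrM (ger0_norm (P0 x y)) ler_wpM2l // distrC.
  by have [_ _ _ +] := zP y.
move: ePP; apply/negP; rewrite -ltNge.
have -> : W / v - exp_reward P F l x =
    (W - Q) / v + (Q - Z * v) / v + (Z - exp_reward P F l x).
  by field; rewrite gt_eqF.
have div4 u : `|u| <= e / 4 * v -> `|u / v| <= e / 4.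
  by move=> u4; rewrite normrM normfV (gtr0_norm vR) ler_pdivrMr.
rewrite (le_lt_trans (ler_normD _ _)) //.
have := ler_normD ((W - Q) / v) ((Q - Z * v) / v).
move: (div4 _ WQ) (div4 _ QZ) Zr e0; lra.
Qed.

(** * Continuity and measurability of the estimator *)

Lemma average_near (R : realType) (S : finType) (Q : S -> S -> R) (r : S -> R) (e : R) :
  irreducible_stochastic Q -> 0 < e ->
  exists2 h : R, 0 < h & forall (Q' : S -> S -> R) (r' : S -> R), stochastic Q' ->
    (forall x y, `|Q' x y - Q x y| < h) -> (forall x, `|r' x - r x| < h) ->
    irreducible_stochastic Q' /\
    `|\sum_x stationary Q' x * r' x - \sum_x stationary Q x * r x| < e.
Proof.
move=> irrQ e0; have [h0 h00 near0] := irreducible_stochastic_near irrQ.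
have [L L0 lip] := stationary_lipschitz irrQ.
pose B := \sum_x (L * (`|r x| + 1) + `|stationary Q x|).
have B0 : 0 <= B by apply: sumr_ge0 => x _; rewrite addr_ge0 // mulr_ge0 // addr_ge0.
pose h1 := e / (B + 1).
have h10 : 0 < h1 by rewrite divr_gt0 // ltr_wpDl.
(* [h0] secures irreducibility, 1 gives |r'| <= |r| + 1, and [h1] makes the resulting bound h B less
   than e. *)
exists (Order.min h0 (Order.min 1 h1)); first by rewrite !lt_min h00 ltr01.
set h := Order.min _ _.
have hh0 : h <= h0 by rewrite ge_min lexx.
have hh1 : h <= 1 by rewrite !ge_min lexx orbT.
have hh2 : h <= h1 by rewrite !ge_min lexx !orbT.
move=> Q' r' stQ' QQ' rr'.
have irrQ' : irreducible_stochastic Q'.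
  by apply: near0 => // x y; exact: lt_le_trans (QQ' x y) hh0.
split=> //.
have lip' := lip Q' h irrQ' (fun x y => ltW (QQ' x y)).
have [[x0 _]|noS] := pselect (exists x : S, True); last first.
  by rewrite !big1 ?subrr ?normr0 // => x _; exfalso; apply: noS; exists x.
have hpos : 0 < h by exact: le_lt_trans (normr_ge0 _) (rr' x0).
apply: (@le_lt_trans _ _ (h * B)).
  rewrite -sumrB /B mulr_sumr; apply: le_trans (ler_norm_sum _ _ _) _.
  apply: ler_sum => x _.
  have -> : stationary Q' x * r' x - stationary Q x * r x =
    (stationary Q' x - stationary Q x) * r' x + stationary Q x * (r' x - r x) by ring.
  rewrite (le_trans (ler_normD _ _)) // !normrM mulrDr lerD //.
    rewrite mulrA [h * L]mulrC ler_pM //.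
    rewrite -[r' x](subrK (r x)) addrC (le_trans (ler_normD _ _)) // lerD2l.
    by rewrite (le_trans (ltW (rr' x))).
  by rewrite mulrC ler_wpM2r // ltW.
apply: (@lt_le_trans _ _ (h * (B + 1))); first by rewrite ltr_pM2l // ltrDl.
by rewrite -ler_pdivlMr ?ltr_wpDl.
Qed.

Lemma Jtime_le (R : realType) (S : finType) (T : Type) (X : nat -> T -> S)
    (A : nat -> T -> 'I_2) (n : nat) (w : T) :
  (Jtime R X A w <= (n%:R)%:E)%E <-> (exists2 k, (k <= n)%N &
    forall l, irreducible_stochastic (Phat R X A k l w)).
Proof.
split=> [Jn|[k kn irr]]; last first.
  by apply: (@le_trans _ _ (k%:R)%:E); [apply: ereal_inf_lbound; exists k|rewrite lee_fin ler_nat].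
apply: contrapT => nok; move: Jn; apply/negP; rewrite -ltNge.
(* If no index up to n qualifies, n + 1 is a lower bound of the set, also when the set is empty and
   the infimum is +oo. *)
apply: (@lt_le_trans _ _ (n.+1%:R)%:E); first by rewrite lte_fin ltr_nat.
apply/ereal_infP => _ [k irr <-]; rewrite lee_fin ler_nat ltnNge.
by apply/negP => kn; apply: nok; exists k.
Qed.

(** States and actions up to time n take finitely many values, so such a set is a finite union of
    measurable fibres. This handles [stationary], which is defined by choice, without a formula for
    it. *)
Lemma measurable_history (R : realType) (S : finType) (d : measure_display)
    (T : measurableType d) (Pr : probability T R) (P : 'I_2 -> S -> S -> R)
    (X : nat -> T -> S) (U V : nat -> T -> R) (A : nat -> T -> 'I_2) (n : nat)
    (D : set T) :
  controlled_process Pr P X U V A ->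
  (forall w w', (forall j, (j <= n)%N -> X j w = X j w' /\ A j w = A j w') ->
    D w -> D w') -> measurable D.
Proof.
move=> hA hD.
pose h w : {ffun 'I_n.+1 -> S * 'I_2} := [ffun j : 'I_n.+1 => (X j w, A j w)].
have mh v : measurable (h @^-1` [set v]).
  rewrite (_ : h @^-1` [set v] = \bigcap_(j in [set: 'I_n.+1]) visit X A (v j).2 (v j).1 j).
    apply: fin_bigcap_measurable => [|j _]; first exact: finite_finset.
    by apply: (filtration_measurable hA (n := j)); exact: filtration_visit hA.
  apply/seteqP; split=> [w /= hw j _|w /= hw].
    by split; rewrite /= -hw ffunE.
  apply/ffunP => j; have [/= Xj Aj] := hw j I.
  by rewrite ffunE Xj Aj -surjective_pairing.
rewrite (_ : D = \bigcup_(v in h @` D) (h @^-1` [set v])).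
  by apply: fin_bigcup_measurable => // ; exact: finite_finset.
apply/seteqP; split=> [w Dw|w [_ [w' Dw' <-] /= hw]].
  by exists (h w) => //; exists w.
apply: hD Dw' => j jn.
have /ffunP/(_ (Ordinal (jn : (j < n.+1)%N))) := hw.
by rewrite !ffunE /= => -[-> ->].
Qed.

Lemma Phat_history (R : realType) (S : finType) (T : Type) (X : nat -> T -> S)
    (A : nat -> T -> 'I_2) (n k : nat) (l : 'I_2) (w w' : T) :
  (k <= n)%N ->
  (forall j, (j <= n)%N -> X j w = X j w' /\ A j w = A j w') ->
  Phat R X A k l w = Phat R X A k l w'.
Proof.
move=> kn ww'; apply/funext => x; apply/funext => y; rewrite /Phat /visits.
have ww j : (j < k)%N -> [/\ X j w = X j w', A j w = A j w' & X j.+1 w = X j.+1 w'].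
  move=> jk; have [-> ->] := ww' j (ltnW (leq_trans jk kn)).
  by have [->] := ww' j.+1 (leq_trans jk kn).
congr (_%:R / (maxn _ 1)%:R); apply: eq_bigr => j _.
  by have [-> -> ->] := ww j (ltn_ord j).
by have [-> -> _] := ww j (ltn_ord j).
Qed.

Lemma Jtime_history (R : realType) (S : finType) (T : Type) (X : nat -> T -> S)
    (A : nat -> T -> 'I_2) (n : nat) (w w' : T) :
  (forall j, (j <= n)%N -> X j w = X j w' /\ A j w = A j w') ->
  (Jtime R X A w <= (n%:R)%:E)%E -> (Jtime R X A w' <= (n%:R)%:E)%E.
Proof.
move=> ww' /Jtime_le[k kn irr]; apply/Jtime_le; exists k => // l.
by rewrite -(Phat_history R l kn ww').
Qed.

(** J and [pihat] depend only on the finite history; the rewards also depend on V, and are treated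
    through [visit_reward] and [measurable_quantile]. *)
Lemma measurable_alphahat (R : realType) (S : finType) (d : measure_display)
    (T : measurableType d) (Pr : probability T R) (P : 'I_2 -> S -> S -> R)
    (F : 'I_2 -> S -> S -> cumulativeBounded (0 : R) 1)
    (X : nat -> T -> S) (U V : nat -> T -> R) (A : nat -> T -> 'I_2) (n : nat) :
  (forall l x y, bounded_support (F l x y)) ->
  controlled_process Pr P X U V A ->
  measurable_fun setT (alphahat F X V A n).
Proof.
move=> hF hA.
pose J w := (Jtime R X A w <= (n%:R)%:E)%E.
have mJ : measurable_fun setT (J : T -> bool).
  apply: (measurable_fun_bool true); rewrite setTI.
  by apply: (measurable_history (n := n) hA) => w w' ww' /=; exact: Jtime_history.
have mp l x : measurable_fun setT (fun w => pihat R X A n l w x).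
  move=> _ B _; rewrite setTI; apply: (measurable_history (n := n) hA) => w w' ww'.
  rewrite /= /pihat (Phat_history R l (leqnn n) ww').
  have -> : (Jtime R X A w <= (n%:R)%:E)%E = (Jtime R X A w' <= (n%:R)%:E)%E.
    apply/idP/idP; apply: Jtime_history => // j jn.
    by have [-> ->] := ww' j jn.
  by [].
have mr l x : measurable_fun setT (fun w => rhat F X V A n l w x).
  rewrite /rhat; apply: measurable_fun_ifT => //; apply: measurable_funM.
    apply: measurable_sum => j; under eq_fun do rewrite visit_reward.
    apply: measurable_sum => y; apply: measurable_funM.
      under eq_fun do rewrite -indic_visit; apply: measurable_indic.
      by apply: (filtration_measurable hA (n := j)); exact: filtration_visit hA.
    apply: measurable_funM.
      rewrite (_ : (fun w => _) = \1_(X j.+1 @^-1` [set y])).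
        by apply: measurable_indic; exact: (cp_X_measurable hA).
      apply/funext => w; rewrite indicE; congr (nat_of_bool _)%:R.
      by apply/eqP/idP; rewrite inE.
    exact: measurableT_comp (measurable_quantile (hF l x y)) (cp_V_measurable hA _).
  move=> _ B _; rewrite setTI; apply: (measurable_history (n := n) hA) => w w' ww'.
  rewrite /= /visits; congr B; congr (_%:R^-1); congr maxn; apply: eq_bigr => j _.
  by have [-> ->] := ww' j (ltnW (ltn_ord j)).
rewrite /alphahat; apply: measurable_fun_ifT => //.
by apply: measurable_funB; apply: measurable_sum => x; apply: measurable_funM.
Qed.

(** * Convergence in probability of the estimator *)

Lemma Phat_stochastic (R : realType) (S : finType) (T : Type) (X : nat -> T -> S)
    (A : nat -> T -> 'I_2) (n : nat) (l : 'I_2) (w : T) :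
  (forall x, visits X A n l x w != 0%N) -> stochastic (Phat R X A n l w).
Proof.
move=> v0; split=> [x y|x]; first by rewrite divr_ge0.
rewrite /Phat -mulr_suml -natr_sum exchange_big /= (maxn_idPl _) ?lt0n //.
rewrite (_ : (\sum_(j < n) _)%N = visits X A n l x w).
  by rewrite divff // pnatr_eq0.
(* Every visit is followed by exactly one state, so the transition counts of a row add up to its
   visit count. *)
apply: eq_bigr => j _; rewrite (bigD1 (X j.+1 w)) //= eqxx andbT.
by rewrite big1 ?addn0 // => y; rewrite eq_sym => /negPf ->; rewrite !andbF.
Qed.

Theorem corollary6 (R : realType) (S : finType)
    (P : 'I_2 -> S -> S -> R)
    (hP : forall l, irreducible_stochastic (P l))
    (F : 'I_2 -> S -> S -> cumulativeBounded (0 : R) 1)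
    (hF : forall l x y, bounded_support (F l x y))
    (d : measure_display) (T : measurableType d) (Pr : probability T R)
    (X : nat -> T -> S) (U V : nat -> T -> R) (A : nat -> T -> 'I_2)
    (hA : controlled_process Pr P X U V A)
    (gamma : 'I_2 -> S -> {RV Pr >-> R})
    (hTAR : TAR Pr X A gamma)
    (hgamma : {ae Pr, forall w, forall l x, 0 < gamma l x w}) :
  cvg_in_prob Pr (alphahat F X V A) (fun=> alpha P F).
Proof.
move=> e e0; apply: outer_vanish_cvg => [n|].
  apply: (@measurable_norm_ge _ _ _ (fun w => alphahat F X V A n w - alpha P F)).
  by apply: measurable_funB => //; exact: measurable_alphahat hF hA.
have stP l : stochastic (P l) := (hP l).1.
have e20 : 0 < e / 2 by rewrite divr_gt0.
have [h1 h10 near1] := average_near (exp_reward P F act1) (hP act1) e20.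
have [h2 h20 near2] := average_near (exp_reward P F act2) (hP act2) e20.
pose h := Order.min h1 h2.
have h0 : 0 < h by rewrite lt_min h10.
have hh1 : h <= h1 by rewrite ge_min lexx.
have hh2 : h <= h2 by rewrite ge_min lexx orbT.
(* The bad events are: some pair is unvisited, some transition estimate is off by h, some reward
   estimate is off by h. Outside them each action contributes an error below e / 2. *)
apply: outer_vanish_sub (outer_vanishU
  (outer_vanish_exists (fun l => outer_vanish_exists (fun x =>
     vanish_unvisited l x hA hTAR hgamma)))
  (outer_vanishU
    (outer_vanish_exists (fun l => outer_vanish_exists (fun x =>
       outer_vanish_exists (fun y => Phat_vanish l x y stP hA hTAR hgamma h0))))
    (outer_vanish_exists (fun l => outer_vanish_exists (fun x =>
       reward_vanish l x stP hF hA hTAR hgamma h0))))).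
apply: filterE => n w /= far; apply: contrapT => nbad; move: far; apply/negP.
rewrite -ltNge.
have stPhat l : stochastic (Phat R X A n l w).
  by apply: Phat_stochastic => x; apply/eqP => v0; apply: nbad; left; exists l, x.
have PP l x y : `|Phat R X A n l w x y - P l x y| < h.
  by rewrite ltNge; apply/negP => ?; apply: nbad; right; left; exists l, x, y.
pose r' l x := (\sum_(j < n) ((X j w == x) && (A j w == l))%:R * reward F X V A j.+1 w)
      / (maxn (visits X A n l x w) 1)%:R.
have rr l x : `|r' l x - exp_reward P F l x| < h.
  by rewrite ltNge; apply/negP => ?; apply: nbad; right; right; exists l, x.
have [irr1 close1] := near1 _ (r' act1) (stPhat act1)
  (fun x y => lt_le_trans (PP act1 x y) hh1) (fun x => lt_le_trans (rr act1 x) hh1).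
have [irr2 close2] := near2 _ (r' act2) (stPhat act2)
  (fun x y => lt_le_trans (PP act2 x y) hh2) (fun x => lt_le_trans (rr act2 x) hh2).
(* Closeness to P makes the estimates at time n irreducible, so n itself witnesses J <= n and the
   estimators do not take their default values. *)
have Jn : (Jtime R X A w <= (n%:R)%:E)%E.
  apply/Jtime_le; exists n => // l.
  have [->|->] // : l = act1 \/ l = act2.
  by case: l => -[|[|//]] ?; [left|right]; apply/val_inj.
rewrite /alphahat Jn /pihat /rhat Jn /alpha /avg_reward.
move: close1 close2; rewrite /r'.
set u1 := \sum_x _; set v1 := \sum_x _; set u2 := \sum_x _; set v2 := \sum_x _.
rewrite !ltr_norml => /andP[? ?] /andP[? ?]; apply/andP; split; lra.
Qed.
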